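(* A PIN model defined on a graph $\mathcal G=(\mathcal M,\mathcal E)$ (a 2-uniform hypergraph) is $R_{\mathrm{SK}}$-maximal if and only if it is Type $\mathcal S$.
   Context: Setup. Let $\mathcal M=\{1,\dots,m\}$, $m\ge2$. Entropies are base 2. $X_A=(X_i:i\in A)$. PIN model. Given $\mathcal G=(\mathcal M,\mathcal E)$ with $\mathcal E$ a finite multiset of 2-element subsets of $\mathcal M$, let $\mathcal E^{(n)}$ contain $n$ copies of each edge. Each $e\in\mathcal E^{(n)}$ carries an independent Bernoulli(1/2) variable $\xi_e$, and terminal $i$ observes $X^n_i=(\xi_e:e\in\mathcal E^{(n)},\ i\in e)$. Interactive communication, CR, SK. An interactive communication $\mathbf F$ (range $\mathcal F$) is a finite sequence of transmissions, each a deterministic function of the sender's $X^n_i$ and earlier transmissions. A CR from $\mathbf F$ is a sequence $\mathbf J$ of functions of $X^n_{\mathcal M}$ such that for every $0<\epsilon<1$ and large $n$, every terminal $i$ can compute $J_i(X^n_i,\mathbf F)$ with $\Pr[J_1=\cdots=J_m=\mathbf J]\ge1-\epsilon$. An SK is such a CR $\mathbf K$ with $I(\mathbf K;\mathbf F)\le\epsilon$ for all large $n$, for each $\epsilon>0$. Multipartite information and Type $\mathcal S$. $\Delta(\mathcal P)=\frac1{|\mathcal P|-1}[\sum_{A\in\mathcal P}H(X_A)-H(X_{\mathcal M})]$ for partitions with $\ge2$ cells, and $\mathbf I(X_{\mathcal M})=\min_{\mathcal P}\Delta(\mathcal P)$ (the SK capacity). The model is Type $\mathcal S$ if the singleton partition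 $\{\{1\},\dots,\{m\}\}$ attains this minimum. Communication rates. $R_{\mathrm{CO}}=\min\{\sum_iR_i:\sum_{i\in B}R_i\ge H(X_B|X_{B^c})\ \forall\emptyset\neq B\subsetneq\mathcal M\}$. $R_{\mathrm{SK}}$ is the infimum of $R\ge0$ such that for every $\epsilon>0$ and large $n$ there exist $\mathbf F$ with $\frac1n\log|\mathcal F|\le R+\epsilon$ and an SK $\mathbf K$ from $\mathbf F$ with $\frac1nH(\mathbf K)\ge\mathbf I(X_{\mathcal M})-\epsilon$. The source is $R_{\mathrm{SK}}$-maximal if $R_{\mathrm{SK}}=R_{\mathrm{CO}}$. *)

(* Defs.v *)
From Stdlib Require Import Reals List Permutation Arith Bool.
Import ListNotations.
Open Scope R_scope.

Fixpoint all_bits (N : nat) : list (list bool) :=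
  match N with
  | O => [ [] ]
  | S k => flat_map (fun l => [false :: l; true :: l]) (all_bits k)
  end.

Definition log2 (x : R) : R := ln x / ln 2.

Definition Rsum (l : list R) : R := fold_right Rplus 0 l.

Definition bdec {T} (eqd : forall x y : T, {x = y} + {x <> y}) (x y : T) : bool :=
  if eqd x y then true else false.

Definition prob (N : nat) (P : list bool -> bool) : R :=
  INR (length (filter P (all_bits N))) / INR (length (all_bits N)).

(* Shannon entropy (base 2) of the random variable f under the uniform
   distribution on N bits:  H(f) = E[ -log2 Pr[f = f(w)] ]. *)
Definition ent {T} (eqd : forall x y : T, {x = y} + {x <> y})
  (N : nat) (f : list bool -> T) : R :=
  let Om := all_bits N in
  let q := INR (length Om) in
  Rsum (map (fun w =>
     - (/ q) * log2 (INR (length (filter (fun w' => bdec eqd (f w') (f w)) Om)) / q))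
     Om).

Definition prod_eq_dec {A B} (da : forall x y : A, {x = y} + {x <> y})
  (db : forall x y : B, {x = y} + {x <> y}) : forall x y : A * B, {x = y} + {x <> y}.
Proof. decide equality. Defined.

Definition mutinf {A B} (da : forall x y : A, {x = y} + {x <> y})
  (db : forall x y : B, {x = y} + {x <> y}) (N : nat)
  (f : list bool -> A) (g : list bool -> B) : R :=
  ent da N f + ent db N g - ent (prod_eq_dec da db) N (fun w => (f w, g w)).

Definition card_range {T} (eqd : forall x y : T, {x = y} + {x <> y})
  (N : nat) (f : list bool -> T) : nat :=
  length (nodup eqd (map f (all_bits N))).

Definition eq_lb := list_eq_dec Bool.bool_dec.
Definition eq_llb := list_eq_dec eq_lb.
Definition eq_ln := list_eq_dec Nat.eq_dec.

(* Terminals are 0,...,m-1.  The graph is a multiset (list) of edges,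
   each edge a 2-element subset {a,b} given as an (unordered) pair, a <> b. *)
Definition valid_graph (m : nat) (E : list (nat * nat)) : Prop :=
  Forall (fun e => (fst e < m)%nat /\ (snd e < m)%nat /\ fst e <> snd e) E.

Definition incident (i : nat) (e : nat * nat) : bool :=
  Nat.eqb i (fst e) || Nat.eqb i (snd e).

(* E^(n): n copies of each edge.  The sample w has length n * |E|; position p
   carries the bit xi_e of the copy (p mod n) of edge number (p / n).
   Terminal i observes X^n_i = (xi_e : i in e). *)
Definition obs (n : nat) (E : list (nat * nat)) (i : nat) (w : list bool) : list bool :=
  map (fun p => nth p w false)
      (filter (fun p => incident i (nth (p / n) E (0%nat, 0%nat))) (seq 0 (n * length E))).

Definition XA (E : list (nat * nat)) (A : list nat) (w : list bool) : list (list bool) :=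
  map (fun i => obs 1 E i w) A.

Definition HX (E : list (nat * nat)) (A : list nat) : R :=
  ent eq_llb (1 * length E) (XA E A).

Definition is_partition (m : nat) (P : list (list nat)) : Prop :=
  Permutation (concat P) (seq 0 m) /\ Forall (fun B => B <> []) P.

Definition Delta (m : nat) (E : list (nat * nat)) (P : list (list nat)) : R :=
  / (INR (length P) - 1) * (Rsum (map (HX E) P) - HX E (seq 0 m)).

Definition is_mmi (m : nat) (E : list (nat * nat)) (c : R) : Prop :=
  (exists P, is_partition m P /\ (2 <= length P)%nat /\ Delta m E P = c) /\
  (forall P, is_partition m P -> (2 <= length P)%nat -> c <= Delta m E P).

Definition singletons (m : nat) : list (list nat) := map (fun i => [i]) (seq 0 m).

Definition typeS (m : nat) (E : list (nat * nat)) : Prop :=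
  forall P, is_partition m P -> (2 <= length P)%nat ->
    Delta m E (singletons m) <= Delta m E P.

(* H(X_B | X_{B^c}) = H(X_M) - H(X_{B^c}). *)
Definition CO_feasible (m : nat) (E : list (nat * nat)) (Rt : nat -> R) : Prop :=
  forall B : nat -> bool,
    (exists i, (i < m)%nat /\ B i = true) ->
    (exists i, (i < m)%nat /\ B i = false) ->
    Rsum (map Rt (filter B (seq 0 m))) >=
      HX E (seq 0 m) - HX E (filter (fun i => negb (B i)) (seq 0 m)).

Definition is_RCO (m : nat) (E : list (nat * nat)) (r : R) : Prop :=
  (exists Rt, CO_feasible m E Rt /\ Rsum (map Rt (seq 0 m)) = r) /\
  (forall Rt, CO_feasible m E Rt -> r <= Rsum (map Rt (seq 0 m))).

(* A transmission: sender index and a deterministic function of the sender's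
   observation and all earlier transmissions. *)
Definition protocol : Type := list (nat * (list bool -> list nat -> nat)).

Fixpoint run (steps : protocol) (obsf : nat -> list bool) (acc : list nat) : list nat :=
  match steps with
  | [] => acc
  | (i, g) :: s => run s obsf (acc ++ [g (obsf i) acc])
  end.

Definition transcript (n : nat) (E : list (nat * nat)) (F : protocol) (w : list bool)
  : list nat := run F (fun i => obs n E i w) [].

Definition SK_achievable (m : nat) (E : list (nat * nat)) (R0 : R) : Prop :=
  exists c, is_mmi m E c /\
  exists (Fs : nat -> protocol) (Ks : nat -> list bool -> nat)
         (Js : nat -> nat -> list bool -> list nat -> nat),
    (forall n, Forall (fun st => (fst st < m)%nat) (Fs n)) /\
    forall eps, eps > 0 -> exists n0, forall n, (1 <= n)%nat -> (n0 <= n)%nat ->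
      let N := (n * length E)%nat in
      let Ftr := transcript n E (Fs n) in
      / INR n * log2 (INR (card_range eq_ln N Ftr)) <= R0 + eps /\
      prob N (fun w => forallb (fun i => Nat.eqb (Js n i (obs n E i w) (Ftr w)) (Ks n w))
                               (seq 0 m)) >= 1 - eps /\
      mutinf Nat.eq_dec eq_ln N (Ks n) Ftr <= eps /\
      / INR n * ent Nat.eq_dec N (Ks n) >= c - eps.

Definition is_glb (S : R -> Prop) (x : R) : Prop :=
  (forall y, S y -> x <= y) /\ (forall z, (forall y, S y -> z <= y) -> z <= x).

Definition is_RSK (m : nat) (E : list (nat * nat)) (r : R) : Prop :=
  is_glb (fun R0 => 0 <= R0 /\ SK_achievable m E R0) r.

Definition RSK_maximal (m : nat) (E : list (nat * nat)) : Prop :=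
  exists r, is_RCO m E r /\ is_RSK m E r.

(* Main.v *)
From Stdlib Require Import Reals List Permutation Arith ZArith Bool Lia Lra.
From Stdlib Require Import Classical ClassicalEpsilon.
Require Import Defs.
Import ListNotations.
Open Scope R_scope.

(* For every PIN graph, R_SK = (m-2) I, where I is the multipartite information, while
   R_CO >= |E| - Delta(P) for every partition P, with equality for the singletons in the
   Type S case.  Since Delta = |E|/(m-1) for the singletons, the two rates agree exactly
   when the singletons attain I.

   Lower bound on R_SK: with L = (K, F), Shearer's inequality (each edge is seen by two
   terminals) gives sum_i H(X_i | L) >= 2 H(X | L), and interactivity gives
   sum_i H(F | X_i) <= (m-1) H(F).  As K is almost a function of (X_i, F) and almost
   independent of F, together they yield H(F) >= (m-2) H(K) up to o(n).

   Upper bound: about n I edge-disjoint spanning trees can be packed into E^(n).  In each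
   of them m-2 broadcasts of sums of two adjacent edge bits reveal the tree up to a global
   flip, so that the bit of the root edge is a secret key. *)

(** Entropies are computed from the kernels of random variables, as equivalence relations on the
    sample space: variables with different types of values then live together and a joint variable
    is an intersection. Submodularity, the log-cardinality bound and Fano's inequality all come from
    log x <= x - 1 followed by a counting of classes. The capacity c enters the packing only through
    cuts: at least c (k - 1) edges cross any partition of the vertices into k cells. The exact
    packing theorem of Nash-Williams and Tutte is avoided, since n (c - eps) trees in n copies of
    the graph are enough. Under this cut condition Kruskal's algorithm finds, for any nonnegative
    edge weights, a spanning tree with at most 1/c of the total weight. Choosing such trees one
    after the other, with weights that grow exponentially in the past use of an edge, keeps every
    edge from being used more than n times. *)

Local Notation sum f l := (Rsum (map f l)).

(** * Finite real sums *)

Lemma sum_ext {T} (f g : T -> R) l :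
  (forall x, In x l -> f x = g x) -> sum f l = sum g l.
Proof. intros H; f_equal; apply map_ext_in; exact H. Qed.

Lemma sum_le {T} (f g : T -> R) l :
  (forall x, In x l -> f x <= g x) -> sum f l <= sum g l.
Proof.
  induction l as [|a l IH]; simpl; intros H; [lra|].
  apply Rplus_le_compat; auto.
Qed.

Lemma sum_plus {T} (f g : T -> R) l :
  sum (fun x => f x + g x) l = sum f l + sum g l.
Proof. induction l as [|a l IH]; simpl; [|rewrite IH]; lra. Qed.

Lemma sum_scal {T} (k : R) (f : T -> R) l :
  sum (fun x => k * f x) l = k * sum f l.
Proof. induction l as [|a l IH]; simpl; [|rewrite IH]; lra. Qed.

Lemma sum_minus {T} (f g : T -> R) l :
  sum (fun x => f x - g x) l = sum f l - sum g l.
Proof. induction l as [|a l IH]; simpl; [|rewrite IH]; lra. Qed.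

Lemma sum_const {T} (k : R) (l : list T) :
  sum (fun _ => k) l = INR (length l) * k.
Proof.
  induction l as [|a l IH]; [simpl; lra|].
  cbn [map Rsum fold_right length]; unfold Rsum in IH; rewrite IH, S_INR; lra.
Qed.

Lemma sum_nonneg {T} (f : T -> R) l :
  (forall x, In x l -> 0 <= f x) -> 0 <= sum f l.
Proof.
  intros H; rewrite <- (Rmult_0_r (INR (length l))), <- (sum_const 0 l).
  apply sum_le; exact H.
Qed.

Lemma sum_app {T} (f : T -> R) l1 l2 : sum f (l1 ++ l2) = sum f l1 + sum f l2.
Proof. induction l1 as [|a l IH]; simpl; [|rewrite IH]; lra. Qed.

Lemma sum_swap {T U} (f : T -> U -> R) l1 l2 :
  sum (fun x => sum (f x) l2) l1 = sum (fun y => sum (fun x => f x y) l1) l2.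
Proof.
  induction l1 as [|a l IH]; simpl.
  - rewrite sum_const; lra.
  - rewrite IH, <- sum_plus; reflexivity.
Qed.

Lemma sum_mult {T U} (f : T -> R) (g : U -> R) l1 l2 :
  sum f l1 * sum g l2 = sum (fun x => sum (fun y => f x * g y) l2) l1.
Proof.
  rewrite Rmult_comm, <- sum_scal; apply sum_ext; intros.
  rewrite sum_scal; apply Rmult_comm.
Qed.

Lemma sum_perm {T} (f : T -> R) l1 l2 : Permutation l1 l2 -> sum f l1 = sum f l2.
Proof. induction 1; simpl; lra. Qed.

Lemma sum_filter {T} (P : T -> bool) (f : T -> R) l :
  sum f (filter P l) = sum (fun x => if P x then f x else 0) l.
Proof.
  induction l as [|a l IH]; simpl; [reflexivity|].
  destruct (P a); simpl; rewrite IH; lra.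
Qed.

Lemma count_sum {T} (P : T -> bool) l :
  INR (length (filter P l)) = sum (fun x => if P x then 1 else 0) l.
Proof.
  rewrite <- (Rmult_1_r (INR _)), <- (sum_const 1), sum_filter; reflexivity.
Qed.

Lemma sum_concat {T} (f : T -> R) L :
  sum f (concat L) = sum (fun l => sum f l) L.
Proof. induction L as [|l L IH]; simpl; [|rewrite sum_app, IH]; reflexivity. Qed.

Lemma sum_NoDup_incl {T} (f : T -> R) l1 l2 :
  NoDup l1 -> incl l1 l2 -> (forall x, In x l2 -> 0 <= f x) ->
  sum f l1 <= sum f l2.
Proof.
  intros Hnd; revert l2; induction Hnd as [|a l Ha Hnd IH]; intros l2 Hincl Hpos.
  - apply sum_nonneg; exact Hpos.
  - destruct (in_split a l2 (Hincl a (or_introl eq_refl))) as (u & v & ->).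
    rewrite (sum_perm f (u ++ a :: v) (a :: u ++ v))
      by (symmetry; apply Permutation_middle).
    simpl; apply Rplus_le_compat_l, IH.
    + intros x Hx; assert (Hx' := Hincl x (or_intror Hx)).
      rewrite in_app_iff in Hx' |- *; simpl in Hx'.
      destruct Hx' as [|[<-|]]; tauto.
    + intros x Hx; apply Hpos; rewrite in_app_iff in *; simpl; tauto.
Qed.

Lemma sum_single (x : nat) (d : R) l :
  NoDup l -> In x l -> sum (fun i => if Nat.eqb i x then d else 0) l = d.
Proof.
  induction 1 as [|a l Ha Hnd IH]; simpl; [tauto|]; intros Hx.
  destruct (Nat.eqb_spec a x) as [->|Hax].
  - rewrite (sum_ext _ (fun _ => 0) l), sum_const; [lra|].
    intros i Hi; destruct (Nat.eqb_spec i x); congruence.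
  - destruct Hx; [congruence|]; rewrite IH by assumption; lra.
Qed.

(** * Base 2 logarithms *)

Lemma ln2_pos : 0 < ln 2.
Proof. rewrite <- ln_1; apply ln_increasing; lra. Qed.

Lemma ln_le_sub1 x : 0 < x -> ln x <= x - 1.
Proof.
  intros Hx; assert (H := exp_ineq1_le (ln x)); rewrite exp_ln in H by lra; lra.
Qed.

Lemma log2_le_sub1 x : 0 < x -> log2 x <= / ln 2 * (x - 1).
Proof.
  intros Hx; unfold log2, Rdiv; rewrite Rmult_comm.
  apply Rmult_le_compat_l, ln_le_sub1; [|assumption].
  left; apply Rinv_0_lt_compat, ln2_pos.
Qed.

Lemma log2_mult x y : 0 < x -> 0 < y -> log2 (x * y) = log2 x + log2 y.
Proof. intros; unfold log2; rewrite ln_mult by assumption; lra. Qed.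

Lemma log2_inv x : 0 < x -> log2 (/ x) = - log2 x.
Proof. intros; unfold log2; rewrite ln_Rinv by assumption; lra. Qed.

Lemma log2_div x y : 0 < x -> 0 < y -> log2 (x / y) = log2 x - log2 y.
Proof.
  intros; unfold Rdiv; rewrite log2_mult, log2_inv; auto with real.
Qed.

Lemma log2_le x y : 0 < x -> x <= y -> log2 x <= log2 y.
Proof.
  intros Hx [Hxy| ->]; [|lra]; unfold log2; apply Rmult_le_compat_r.
  - left; apply Rinv_0_lt_compat, ln2_pos.
  - left; apply ln_increasing; assumption.
Qed.

Lemma log2_1 : log2 1 = 0.
Proof. unfold log2; rewrite ln_1; lra. Qed.

Lemma log2_pow2 n : log2 (2 ^ n) = INR n.
Proof.
  unfold log2; rewrite ln_pow by lra; field; apply Rgt_not_eq, ln2_pos.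
Qed.

(** * Entropy of a finite equivalence relation *)

Section Entropy.

Context {T : Type}.
Implicit Types (r s : T -> T -> bool) (Om : list T).

Definition equivb r :=
  (forall x, r x x = true) /\ (forall x y, r x y = true -> r y x = true) /\
  (forall x y z, r x y = true -> r y z = true -> r x z = true).

(** The kernel of a pair of variables. Conditional entropy H(f|g) is written
    [entR Om (meet f g) - entR Om g]. *)
Definition meet r s := fun x y => r x y && s x y.

Definition total := fun _ _ : T => true.

Definition class_size Om r w := INR (length (filter (fun w' => r w' w) Om)).

(* [ent] only depends on the partition of the sample space into fibres. *)
Definition entR Om r : R :=
  sum (fun w => - / INR (length Om) * log2 (class_size Om r w / INR (length Om))) Om.

Lemma equivb_meet r s : equivb r -> equivb s -> equivb (meet r s).
Proof.
  unfold meet; intros (Hr1 & Hr2 & Hr3) (Hs1 & Hs2 & Hs3); repeat split.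
  - intros x; rewrite Hr1, Hs1; reflexivity.
  - intros x y; rewrite !andb_true_iff; intuition.
  - intros x y z; rewrite !andb_true_iff; intros [] []; eauto.
Qed.

Lemma equivb_total : equivb total.
Proof. repeat split. Qed.

Lemma length_pos Om w : In w Om -> 0 < INR (length Om).
Proof. destruct Om; [intros []|intros _]; apply lt_0_INR; simpl; lia. Qed.

Lemma class_size_ge1 Om r w : equivb r -> In w Om -> 1 <= class_size Om r w.
Proof.
  intros [Hr _] Hw; unfold class_size; change 1 with (INR 1); apply le_INR.
  assert (H : In w (filter (fun w' => r w' w) Om)) by (apply filter_In; auto).
  destruct (filter _ Om); [destruct H|simpl; lia].
Qed.

Lemma class_size_le Om r s w v :
  (forall x, In x Om -> r x w = true -> s x v = true) ->
  class_size Om r w <= class_size Om s v.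
Proof.
  intros H; unfold class_size; rewrite !count_sum; apply sum_le; intros x Hx.
  specialize (H x Hx); destruct (r x w), (s x v); try lra.
Qed.

Lemma class_size_eq Om r w v : equivb r -> r w v = true ->
  class_size Om r w = class_size Om r v.
Proof.
  intros (_ & Hs & Ht) H; apply Rle_antisym; apply class_size_le; eauto.
Qed.

Lemma entR_le Om r s : equivb r ->
  (forall x y, In x Om -> In y Om -> r x y = true -> s x y = true) ->
  entR Om s <= entR Om r.
Proof.
  intros Hr H; apply sum_le; intros w Hw.
  assert (Hq := length_pos Om w Hw); assert (H1 := class_size_ge1 Om r w Hr Hw).
  assert (log2 (class_size Om r w / INR (length Om))
          <= log2 (class_size Om s w / INR (length Om))).
  { apply log2_le; [apply Rdiv_lt_0_compat; lra|].
    apply Rmult_le_compat_r; [left; apply Rinv_0_lt_compat; lra|].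
    apply class_size_le; auto. }
  assert (0 < / INR (length Om)) by (apply Rinv_0_lt_compat; lra); nra.
Qed.

Lemma entR_ext Om r s : equivb r -> equivb s ->
  (forall x y, In x Om -> In y Om -> (r x y = true <-> s x y = true)) ->
  entR Om r = entR Om s.
Proof.
  intros Hr Hs H; apply Rle_antisym; apply entR_le; auto; intros; apply H; auto.
Qed.

Lemma entR_total Om : entR Om total = 0.
Proof.
  unfold entR, class_size, total.
  rewrite (sum_ext _ (fun _ => 0)); [rewrite sum_const; lra|].
  intros w Hw; assert (Hq := length_pos Om w Hw).
  assert (E : forall l : list T, filter (fun _ => true) l = l)
    by (induction l; simpl; congruence).
  rewrite E, Rdiv_diag, log2_1; lra.
Qed.

(** The set [P] lies inside one class C, so each of its at most |C| elements contributes 1/|C|. *)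
Lemma sum_inv_class Om r (P : T -> bool) : equivb r ->
  (forall x y, P x = true -> P y = true -> r x y = true) ->
  sum (fun w => if P w then / class_size Om r w else 0) Om <= 1.
Proof.
  intros Hr HP; destruct (existsb P Om) eqn:HE.
  - apply existsb_exists in HE; destruct HE as (v & Hv & HPv).
    assert (H1 := class_size_ge1 Om r v Hr Hv).
    rewrite (sum_ext _ (fun w => / class_size Om r v * (if P w then 1 else 0))).
    2:{ intros w Hw; destruct (P w) eqn:HPw; [|lra].
        rewrite (class_size_eq Om r w v) by auto; lra. }
    rewrite sum_scal, <- count_sum.
    apply Rmult_le_reg_l with (class_size Om r v); [lra|].
    rewrite <- Rmult_assoc, Rinv_r, Rmult_1_l, Rmult_1_r by lra.
    apply (class_size_le Om (fun x _ => P x) r v v); auto.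
  - rewrite (sum_ext _ (fun _ => 0)); [rewrite sum_const; lra|].
    intros w Hw; destruct (P w) eqn:HPw; [|reflexivity].
    assert (existsb P Om = true) by (apply existsb_exists; eauto); congruence.
Qed.

(** Double counting. The numerator counts pairs (u, v) with u in the [f],[h]-class and v in the
    [g],[h]-class of w. For a fixed pair all such w lie in one class of the common refinement and
    together contribute at most 1/|class of u in [h]|; each u has exactly that many partners v. *)
Lemma sum_class_ratio Om f g h : equivb f -> equivb g -> equivb h ->
  sum (fun w => class_size Om (meet f h) w * class_size Om (meet g h) w /
    (class_size Om (meet (meet f g) h) w * class_size Om h w)) Om
  <= INR (length Om).
Proof.
  intros Hf Hg Hh; set (fgh := meet (meet f g) h).
  assert (Hfgh : equivb fgh) by (repeat apply equivb_meet; assumption).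
  transitivity (sum (fun w => sum (fun u => sum (fun v =>
     (if h v u then / class_size Om h u else 0) *
     (if f u w && g v w && h u w then / class_size Om fgh w else 0)) Om) Om) Om).
  - apply sum_le; intros w Hw.
    assert (H1 := class_size_ge1 Om fgh w Hfgh Hw).
    assert (H2 := class_size_ge1 Om h w Hh Hw).
    unfold Rdiv; unfold class_size at 1 2; rewrite !count_sum, sum_mult.
    rewrite Rmult_comm, <- sum_scal; apply sum_le; intros u Hu.
    rewrite <- sum_scal; apply sum_le; intros v Hv.
    unfold meet; destruct Hh as (Hr & Hs & Ht).
    assert (P1 : 0 < / class_size Om fgh w) by (apply Rinv_0_lt_compat; lra).
    destruct (f u w), (g v w), (h u w) eqn:Huw, (h v w) eqn:Hvw; simpl;
      try (destruct (h v u); lra); rewrite ?Rmult_0_l, ?Rmult_0_r; try lra.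
    + rewrite (Ht v w u) by auto.
      rewrite (class_size_eq Om h u w) by (repeat split; auto).
      rewrite Rinv_mult; lra.
    + destruct (h v u) eqn:Hvu; [|lra].
      rewrite (Ht v u w) in Hvw by auto; discriminate.
  - transitivity (sum (fun u => sum (fun v =>
      if h v u then / class_size Om h u else 0) Om) Om).
    + rewrite sum_swap; apply sum_le; intros u Hu.
      rewrite sum_swap; apply sum_le; intros v Hv; rewrite sum_scal.
      rewrite <- Rmult_1_r; apply Rmult_le_compat_l.
      * destruct (h v u); [|lra]; left; apply Rinv_0_lt_compat.
        assert (H := class_size_ge1 Om h u Hh Hu); lra.
      * apply (sum_inv_class Om fgh (fun w => f u w && g v w && h u w)); auto.
        destruct Hf as (_ & Hfs & Hft), Hg as (_ & Hgs & Hgt), Hh as (_ & Hhs & Hht).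
        intros x y; unfold fgh, meet; rewrite !andb_true_iff.
        intros [[]] [[]]; repeat split; eauto.
    + rewrite (sum_ext _ (fun _ => 1)); [rewrite sum_const; lra|].
      intros u Hu; assert (H := class_size_ge1 Om h u Hh Hu).
      rewrite (sum_ext _ (fun v => / class_size Om h u * (if h v u then 1 else 0)))
        by (intros v _; destruct (h v u); lra).
      rewrite sum_scal, <- count_sum; apply Rinv_l; unfold class_size in H; lra.
Qed.

(** The difference of the two sides is the mean of the logarithm of the ratio in [sum_class_ratio];
    log x <= x - 1 replaces it by the mean of the ratio minus 1, which is at most 0. *)
Lemma entR_submod Om f g h : equivb f -> equivb g -> equivb h ->
  entR Om (meet (meet f g) h) + entR Om h
  <= entR Om (meet f h) + entR Om (meet g h).
Proof.
  intros Hf Hg Hh; assert (HR := sum_class_ratio Om f g h Hf Hg Hh).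
  set (rat := fun w => _ / _) in HR.
  assert (HOm : Om = [] \/ 0 < INR (length Om)).
  { destruct Om as [|w0 Om']; [left|right; apply (length_pos _ w0)]; simpl; auto. }
  destruct HOm as [->|Hq]; [unfold entR; simpl; lra|].
  set (q := INR (length Om)) in *; assert (0 < / q) by (apply Rinv_0_lt_compat; lra).
  assert (0 < / ln 2) by (apply Rinv_0_lt_compat, ln2_pos).
  assert (HD : entR Om (meet (meet f g) h) + entR Om h
            - (entR Om (meet f h) + entR Om (meet g h))
            <= sum (fun w => / q * / ln 2 * (rat w - 1)) Om).
  { unfold entR; rewrite <- !sum_plus, <- sum_minus; apply sum_le; intros w Hw.
    fold q; unfold rat.
    assert (H1 := class_size_ge1 Om (meet f h) w (equivb_meet _ _ Hf Hh) Hw).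
    assert (H2 := class_size_ge1 Om (meet g h) w (equivb_meet _ _ Hg Hh) Hw).
    assert (H3 := class_size_ge1 Om h w Hh Hw).
    assert (H4 := class_size_ge1 Om (meet (meet f g) h) w
              (equivb_meet _ _ (equivb_meet _ _ Hf Hg) Hh) Hw).
    set (a := class_size Om (meet f h) w) in *.
    set (b := class_size Om (meet g h) w) in *.
    set (d := class_size Om h w) in *.
    set (e := class_size Om (meet (meet f g) h) w) in *.
    assert (HL : log2 (a * b / (e * d)) <= / ln 2 * (a * b / (e * d) - 1))
      by (apply log2_le_sub1, Rdiv_lt_0_compat; apply Rmult_lt_0_compat; lra).
    rewrite log2_div, !log2_mult in HL by (try apply Rmult_lt_0_compat; lra).
    rewrite !log2_div by lra.
    apply (Rmult_le_compat_l (/ q)) in HL; lra. }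
  rewrite sum_scal, sum_minus, sum_const in HD; fold q in HD.
  assert (0 < / q * / ln 2) by nra; nra.
Qed.

(** Conditioning on a finer relation lowers entropy: submodularity in which [g] absorbs [h]. *)
Lemma entR_cond_le Om f g h : equivb f -> equivb g -> equivb h ->
  (forall x y, g x y = true -> h x y = true) ->
  entR Om (meet f g) - entR Om g <= entR Om (meet f h) - entR Om h.
Proof.
  intros Hf Hg Hh Hgh; assert (H := entR_submod Om f g h Hf Hg Hh).
  rewrite (entR_ext Om (meet (meet f g) h) (meet f g)) in H;
    [|auto using equivb_meet..|].
  - rewrite (entR_ext Om (meet g h) g) in H; [lra|auto using equivb_meet..|].
    unfold meet; intros x y _ _; rewrite andb_true_iff; intuition.
  - unfold meet; intros x y _ _; rewrite !andb_true_iff; intuition.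
Qed.

Lemma entR_subadd Om f g : equivb f -> equivb g ->
  entR Om (meet f g) <= entR Om f + entR Om g.
Proof.
  intros Hf Hg; assert (H := entR_cond_le Om f g total Hf Hg equivb_total).
  rewrite entR_total, (entR_ext Om (meet f total) f) in H;
    [..|auto using equivb_meet, equivb_total|auto|].
  - specialize (H (fun _ _ _ => eq_refl)); lra.
  - unfold meet, total; intros; rewrite andb_true_r; reflexivity.
Qed.

Section Kernel.

Context {U : Type} (eqd : forall x y : U, {x = y} + {x <> y}).

Definition ker (f : T -> U) : T -> T -> bool := fun x y => bdec eqd (f x) (f y).

Lemma kerP f x y : ker f x y = true <-> f x = f y.
Proof. unfold ker, bdec; destruct (eqd _ _); split; congruence. Qed.

Lemma equivb_ker f : equivb (ker f).
Proof. repeat split; intros *; rewrite !kerP; congruence. Qed.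

(** Gibbs' inequality against the uniform distribution on [Y]. *)
Lemma entR_ker_le_log Om f (Y : list U) : Om <> [] ->
  (forall w, In w Om -> In (f w) Y) ->
  entR Om (ker f) <= log2 (INR (length Y)).
Proof.
  intros Hne HY.
  destruct Om as [|w0 Om'] eqn:HOm; [congruence|]; rewrite <- HOm in *; clear Hne.
  assert (Hw0 : In w0 Om) by (subst; simpl; auto).
  assert (Hq := length_pos Om w0 Hw0).
  assert (HyY : 0 < INR (length Y)).
  { specialize (HY w0 Hw0); destruct Y; [destruct HY|apply lt_0_INR; simpl; lia]. }
  set (q := INR (length Om)) in *; set (k := INR (length Y)) in *.
  assert (0 < / q) by (apply Rinv_0_lt_compat; lra).
  assert (0 < / k) by (apply Rinv_0_lt_compat; lra).
  assert (0 < / ln 2) by (apply Rinv_0_lt_compat, ln2_pos).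
  assert (Hr := equivb_ker f).
  (* The elements of one fibre contribute 1 in total, so this sum counts the values that [f]
     takes. *)
  assert (HC : sum (fun w => / class_size Om (ker f) w) Om <= k).
  { transitivity (sum (fun w => sum (fun y =>
       if bdec eqd (f w) y then / class_size Om (ker f) w else 0) Y) Om).
    - apply sum_le; intros w Hw.
      transitivity (sum (fun y =>
        if bdec eqd (f w) y then / class_size Om (ker f) w else 0) [f w]).
      + simpl; unfold bdec; destruct (eqd _ _); [lra|congruence].
      + apply sum_NoDup_incl.
        * repeat constructor; auto.
        * intros y [<-|[]]; auto.
        * intros y _; assert (H2 := class_size_ge1 Om (ker f) w Hr Hw).
          destruct (bdec _ _ _); [left; apply Rinv_0_lt_compat|]; lra.
    - rewrite sum_swap; unfold k; rewrite <- (Rmult_1_r (INR _)), <- sum_const.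
      apply sum_le; intros y _.
      apply (sum_inv_class Om (ker f) (fun w => bdec eqd (f w) y)); auto.
      intros x z; unfold bdec; rewrite kerP.
      destruct (eqd (f x) y), (eqd (f z) y); congruence. }
  assert (HD : entR Om (ker f) - log2 k
     <= sum (fun w => / ln 2 * (/ k * / class_size Om (ker f) w - / q)) Om).
  { replace (log2 k) with (sum (fun _ : T => / q * log2 k) Om)
      by (rewrite sum_const; unfold q in *; field; lra).
    unfold entR; rewrite <- sum_minus; apply sum_le; intros w Hw; fold q.
    assert (H2 := class_size_ge1 Om (ker f) w Hr Hw).
    set (a := class_size Om (ker f) w) in *.
    assert (HL : log2 (q / (a * k)) <= / ln 2 * (q / (a * k) - 1))
      by (apply log2_le_sub1, Rdiv_lt_0_compat; [|apply Rmult_lt_0_compat]; lra).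
    rewrite log2_div, log2_mult in HL by (try apply Rmult_lt_0_compat; lra).
    rewrite log2_div by lra.
    replace (/ ln 2 * (/ k * / a - / q)) with (/ q * (/ ln 2 * (q / (a * k) - 1)))
      by (field; repeat split; try lra; apply Rgt_not_eq, ln2_pos).
    apply (Rmult_le_compat_l (/ q)) in HL; lra. }
  rewrite sum_scal, sum_minus, sum_scal, sum_const in HD; fold q in HD.
  rewrite Rinv_r in HD by lra.
  assert (/ k * sum (fun w => / class_size Om (ker f) w) Om <= 1).
  { rewrite <- (Rinv_l k) by lra; apply Rmult_le_compat_l; lra. }
  nra.
Qed.

End Kernel.

End Entropy.

(** * Uniform bit strings and the entropy of a set of bits *)

Lemma ent_entR {T} (eqd : forall x y : T, {x = y} + {x <> y}) N f :
  ent eqd N f = entR (all_bits N) (ker eqd f).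
Proof. reflexivity. Qed.

Lemma ent_pair {A B} (da : forall x y : A, {x = y} + {x <> y})
  (db : forall x y : B, {x = y} + {x <> y}) N (f : list bool -> A) (g : list bool -> B) :
  ent (prod_eq_dec da db) N (fun w => (f w, g w))
  = entR (all_bits N) (meet (ker da f) (ker db g)).
Proof.
  rewrite ent_entR; apply entR_ext; auto using equivb_meet, equivb_ker.
  intros x y _ _; unfold meet; rewrite andb_true_iff, !kerP.
  split; [intros H; injection H; auto|intros [-> ->]; reflexivity].
Qed.

Lemma all_bits_length_in N w : In w (all_bits N) -> length w = N.
Proof.
  revert w; induction N as [|N IH]; simpl; intros w Hw.
  - destruct Hw as [<-|[]]; reflexivity.
  - apply in_flat_map in Hw; destruct Hw as (l & Hl & [<-|[<-|[]]]);
      simpl; rewrite (IH l Hl); reflexivity.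
Qed.

Lemma length_all_bits N : length (all_bits N) = (2 ^ N)%nat.
Proof.
  induction N as [|N IH]; [reflexivity|]; simpl.
  rewrite (flat_map_constant_length (c := 2)), IH; [lia|reflexivity].
Qed.

Lemma INR_length_all_bits N : INR (length (all_bits N)) = 2 ^ N.
Proof. rewrite length_all_bits, pow_INR; reflexivity. Qed.

Lemma NoDup_all_bits N : NoDup (all_bits N).
Proof.
  induction N as [|N IH]; simpl; [repeat constructor; auto|].
  induction IH as [|l L Hl Hnd IH]; simpl; [constructor|].
  assert (Hin : forall b, ~ In (b :: l) (flat_map (fun l => [false :: l; true :: l]) L)).
  { intros b Hb; apply in_flat_map in Hb.
    destruct Hb as (l' & Hl' & [E|[E|[]]]); injection E; intros; subst; auto. }
  constructor; [|constructor; auto].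
  intros [E|E]; [discriminate|apply (Hin _ E)].
Qed.

Lemma all_bits_nonempty N : all_bits N <> [].
Proof.
  intros H; assert (HL := INR_length_all_bits N); rewrite H in HL; simpl in HL.
  assert (0 < 2 ^ N) by (apply pow_lt; lra); lra.
Qed.

Definition bit_eq (p : nat) : list bool -> list bool -> bool :=
  ker bool_dec (fun w => nth p w false).

Definition agree (A : list nat) (x y : list bool) : bool :=
  forallb (fun p => bit_eq p x y) A.

Lemma agreeP A x y :
  agree A x y = true <-> forall p, In p A -> nth p x false = nth p y false.
Proof.
  unfold agree; rewrite forallb_forall.
  split; intros H p Hp; apply (kerP bool_dec (fun w => nth p w false)), H, Hp.
Qed.

Lemma equivb_agree A : equivb (agree A).
Proof.
  repeat split; intros *; rewrite !agreeP; intros; auto.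
  - symmetry; auto.
  - etransitivity; auto.
Qed.

Lemma agree_full N x y : In x (all_bits N) -> In y (all_bits N) ->
  agree (seq 0 N) x y = true -> x = y.
Proof.
  intros Hx Hy; rewrite agreeP; intros H.
  apply all_bits_length_in in Hx; apply all_bits_length_in in Hy.
  apply (nth_ext x y false false); [congruence|].
  intros p Hp; apply H, in_seq; lia.
Qed.

Lemma entR_discrete N r : equivb r ->
  (forall x y, In x (all_bits N) -> In y (all_bits N) -> r x y = true -> x = y) ->
  INR N <= entR (all_bits N) r.
Proof.
  intros Hr H; set (q := 2 ^ N); assert (0 < q) by (apply pow_lt; lra).
  assert (E : sum (fun _ => / q * INR N) (all_bits N) = INR N)
    by (rewrite sum_const, INR_length_all_bits; fold q; field; lra).
  rewrite <- E at 1; apply sum_le; intros w Hw; rewrite INR_length_all_bits; fold q.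
  assert (H1 := class_size_ge1 _ r w Hr Hw).
  replace (class_size (all_bits N) r w) with 1.
  - unfold Rdiv; rewrite Rmult_1_l, log2_inv by assumption.
    unfold q; rewrite log2_pow2; lra.
  - apply Rle_antisym; [assumption|]; unfold class_size; change 1 with (INR 1).
    apply le_INR, (NoDup_incl_length (l' := [w])).
    + apply NoDup_filter, NoDup_all_bits.
    + intros v Hv; apply filter_In in Hv; simpl; left; symmetry; apply H; tauto.
Qed.

Lemma entR_agree_le N A : entR (all_bits N) (agree A) <= INR (length A).
Proof.
  induction A as [|p A IH].
  - change (entR (all_bits N) total <= 0); rewrite entR_total; lra.
  - cbn [length]; rewrite S_INR.
    assert (H := entR_subadd (all_bits N) (bit_eq p) (agree A)
                   (equivb_ker _ _) (equivb_agree A)).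
    assert (Hp : entR (all_bits N) (bit_eq p) <= 1).
    { replace 1 with (log2 (INR (length [true; false])))
        by (simpl; replace (1 + 1) with (2 ^ 1) by ring; apply (log2_pow2 1)).
      apply (entR_ker_le_log bool_dec _ _ [true; false]);
        [apply all_bits_nonempty|].
      intros w _; destruct (nth p w false); simpl; auto. }
    change (agree (p :: A)) with (meet (bit_eq p) (agree A)); lra.
Qed.

(** No class size is computed. With B the complement of A, N <= H(A,B) <= H(A) + H(B) and H(B) <=
    |B| <= N - |A|. *)
Lemma entR_agree N A : NoDup A -> incl A (seq 0 N) ->
  entR (all_bits N) (agree A) = INR (length A).
Proof.
  intros Hnd Hincl; apply Rle_antisym; [apply entR_agree_le|].
  set (B := filter (fun p => negb (existsb (Nat.eqb p) A)) (seq 0 N)).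
  assert (HB : forall p, In p B <-> In p (seq 0 N) /\ ~ In p A).
  { intros p; unfold B; rewrite filter_In, negb_true_iff, <- not_true_iff_false.
    rewrite existsb_exists; split; intros [H1 H2]; split; auto; intros H3; apply H2.
    - exists p; rewrite Nat.eqb_eq; auto.
    - destruct H3 as (p' & Hp' & E); apply Nat.eqb_eq in E; congruence. }
  assert (Hlen : (length A + length B <= N)%nat).
  { rewrite <- length_app, <- (length_seq N 0); apply NoDup_incl_length.
    - apply NoDup_app; auto.
      + apply NoDup_filter, seq_NoDup.
      + intros p Hp HpB; apply HB in HpB; tauto.
    - apply incl_app; [assumption|]; intros p Hp; apply HB in Hp; tauto. }
  assert (HN : INR N <= entR (all_bits N) (meet (agree A) (agree B))).
  { apply entR_discrete; [apply equivb_meet; apply equivb_agree|].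
    intros x y Hx Hy HM; apply (agree_full N); auto.
    unfold meet in HM; rewrite andb_true_iff, !agreeP in HM; rewrite agreeP.
    intros p Hp; destruct (in_dec Nat.eq_dec p A); [apply (proj1 HM); assumption|].
    apply (proj2 HM), HB; auto. }
  assert (HS := entR_subadd (all_bits N) _ _ (equivb_agree A) (equivb_agree B)).
  assert (HBl := entR_agree_le N B).
  apply le_INR in Hlen; rewrite plus_INR in Hlen; lra.
Qed.

(** * The PIN model *)

Definition edge_at (E : list (nat * nat)) (j : nat) : nat * nat := nth j E (0%nat, 0%nat).

Definition touches (A : list nat) (e : nat * nat) : bool :=
  existsb (fun i => incident i e) A.

Definition positions (n : nat) (E : list (nat * nat)) (i : nat) : list nat :=
  filter (fun p => incident i (edge_at E (p / n))) (seq 0 (n * length E)).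

Lemma incidentP i e : incident i e = true <-> i = fst e \/ i = snd e.
Proof. unfold incident; rewrite orb_true_iff, !Nat.eqb_eq; tauto. Qed.

Lemma touchesP A e : touches A e = true <-> In (fst e) A \/ In (snd e) A.
Proof.
  unfold touches; rewrite existsb_exists; split.
  - intros (i & Hi & He); apply incidentP in He.
    destruct He as [<-|<-]; auto.
  - intros [H|H]; eexists; (split; [exact H|]); apply incidentP; auto.
Qed.

Lemma obs_eq n E i x y :
  obs n E i x = obs n E i y <-> agree (positions n E i) x y = true.
Proof.
  rewrite agreeP.
  change (obs n E i) with (fun w => map (fun p => nth p w false) (positions n E i)).
  cbv beta.
  generalize (positions n E i) as L; induction L as [|p L IH]; simpl.
  - split; [tauto|reflexivity].
  - split; [intros H; injection H as H1 H2|intros H].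
    + intros p' [<-|Hp']; [assumption|]; revert p' Hp'; apply IH; assumption.
    + f_equal; [|apply IH]; auto.
Qed.

(** Turns source entropies into edge counts, so that [Delta] and the omniscience constraints become
    combinatorial. *)
Lemma HX_touches E A :
  HX E A = INR (length (filter (fun j => touches A (edge_at E j)) (seq 0 (length E)))).
Proof.
  unfold HX; rewrite ent_entR, Nat.mul_1_l.
  rewrite (entR_ext _ _
    (agree (filter (fun j => touches A (edge_at E j)) (seq 0 (length E))))).
  - apply entR_agree; [apply NoDup_filter, seq_NoDup|apply incl_filter].
  - apply equivb_ker.
  - apply equivb_agree.
  - intros x y _ _; rewrite kerP, agreeP; unfold XA; split.
    + intros H p Hp; apply filter_In in Hp; destruct Hp as [Hp HA].
      unfold touches in HA; apply existsb_exists in HA; destruct HA as (i & Hi & He).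
      assert (Hx : obs 1 E i x = obs 1 E i y).
      { exact (ext_in_map (f := fun i => obs 1 E i x) (g := fun i => obs 1 E i y) H i Hi). }
      apply obs_eq in Hx; rewrite agreeP in Hx; apply Hx, filter_In.
      rewrite Nat.mul_1_l, Nat.div_1_r; auto.
    + intros H; apply map_ext_in; intros i Hi; apply obs_eq, agreeP; intros p Hp.
      apply filter_In in Hp; rewrite Nat.mul_1_l, Nat.div_1_r in Hp.
      apply H, filter_In; split; [tauto|].
      apply existsb_exists; exists i; tauto.
Qed.

Lemma valid_edge m E j : valid_graph m E -> (j < length E)%nat ->
  (fst (edge_at E j) < m)%nat /\ (snd (edge_at E j) < m)%nat /\
  fst (edge_at E j) <> snd (edge_at E j).
Proof.
  intros HE Hj; unfold valid_graph in HE; rewrite Forall_forall in HE.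
  apply HE, nth_In, Hj.
Qed.

Lemma div_edge_lt n k p : (p < n * k)%nat -> (p / n < k)%nat.
Proof. intros Hp; apply Nat.Div0.div_lt_upper_bound; assumption. Qed.

Lemma sum_incident m E j d : valid_graph m E -> (j < length E)%nat ->
  sum (fun i => if incident i (edge_at E j) then d else 0) (seq 0 m) = 2 * d.
Proof.
  intros HE Hj; destruct (valid_edge m E j HE Hj) as (H1 & H2 & H3).
  rewrite (sum_ext _ (fun i => (if Nat.eqb i (fst (edge_at E j)) then d else 0) +
                               (if Nat.eqb i (snd (edge_at E j)) then d else 0))).
  - rewrite sum_plus, !sum_single; try apply seq_NoDup; try (apply in_seq; lia); lra.
  - intros i _; unfold incident.
    destruct (Nat.eqb_spec i (fst (edge_at E j))), (Nat.eqb_spec i (snd (edge_at E j)));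
      simpl; try lra; congruence.
Qed.

(** * Lower bound on the communication rate *)

Lemma agree_snoc A p x y : agree (A ++ [p]) x y = bit_eq p x y && agree A x y.
Proof.
  unfold agree; rewrite forallb_app; simpl.
  rewrite andb_true_r; apply andb_comm.
Qed.

Lemma entR_agree_snoc N A p L : equivb L ->
  entR (all_bits N) (meet (agree (A ++ [p])) L) =
  entR (all_bits N) (meet (bit_eq p) (meet (agree A) L)).
Proof.
  intros HL; apply entR_ext.
  - apply equivb_meet; [apply equivb_agree|assumption].
  - apply equivb_meet; [apply equivb_ker|].
    apply equivb_meet; [apply equivb_agree|assumption].
  - intros x y _ _; unfold meet; rewrite agree_snoc, !andb_true_iff; tauto.
Qed.

(* Conditional Shearer inequality: every position is seen by exactly two terminals. *)
Lemma shearer m n E L : valid_graph m E -> equivb L ->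
  2 * INR (n * length E) + (INR m - 2) * entR (all_bits (n * length E)) L
  <= sum (fun i => entR (all_bits (n * length E)) (meet (agree (positions n E i)) L))
       (seq 0 m).
Proof.
  intros HE HL; set (N := (n * length E)%nat); set (H := entR (all_bits N)).
  assert (HA : forall A, equivb (meet (agree A) L))
    by (intros; apply equivb_meet; [apply equivb_agree|assumption]).
  (* The bits are revealed in order. Bit [t] adds [d] given [L] and all earlier bits; it adds at
     least [d] for each of the two terminals that see it, because they condition on fewer bits. *)
  assert (Hind : forall t, (t <= N)%nat ->
    2 * (H (meet (agree (seq 0 t)) L) - H L) <=
    sum (fun i => H (meet (agree
      (filter (fun p => incident i (edge_at E (p / n))) (seq 0 t))) L) - H L) (seq 0 m)).
  { induction t as [|t IH]; intros Ht.
    - simpl; change (agree []) with (@total (list bool)).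
      change (meet total L) with (fun x y => L x y).
      rewrite sum_const; change (fun x y => L x y) with L; lra.
    - specialize (IH ltac:(lia)); set (d := H (meet (agree (seq 0 (S t))) L)
                                          - H (meet (agree (seq 0 t)) L)).
      assert (Hj : (t / n < length E)%nat) by (apply div_edge_lt; unfold N in Ht; lia).
      rewrite <- (Rplus_0_r (2 * _)).
      transitivity (sum (fun i => (H (meet (agree
        (filter (fun p => incident i (edge_at E (p / n))) (seq 0 t))) L) - H L) +
        (if incident i (edge_at E (t / n)) then d else 0)) (seq 0 m)).
      + rewrite sum_plus, (sum_incident m E (t / n) d HE Hj); unfold d; lra.
      + apply sum_le; intros i _; unfold d; rewrite seq_S, filter_app; simpl.
        destruct (incident i (edge_at E (t / n))); [|rewrite app_nil_r; lra].
        unfold H; rewrite !entR_agree_snoc by assumption.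
        assert (HC := entR_cond_le (all_bits N) (bit_eq t) (meet (agree (seq 0 t)) L)
          (meet (agree (filter (fun p => incident i (edge_at E (p / n))) (seq 0 t))) L)).
        specialize (HC (equivb_ker _ _) (HA _) (HA _)).
        apply Rplus_le_reg_r with
          (- entR (all_bits N) (meet (agree (filter
             (fun p => incident i (edge_at E (p / n))) (seq 0 t))) L)).
        enough (Himp : forall x y, meet (agree (seq 0 t)) L x y = true ->
          meet (agree (filter (fun p => incident i (edge_at E (p / n))) (seq 0 t))) L x y
          = true) by (specialize (HC Himp); lra).
        intros x y; unfold meet; rewrite !andb_true_iff, !agreeP.
        intros [HM ?]; split; [|assumption].
        intros p Hp; apply HM; apply filter_In in Hp; tauto. }
  specialize (Hind N (Nat.le_refl N)).
  rewrite sum_minus, sum_const, length_seq in Hind.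
  (* All bits together determine the sample, so 2 (N - H(L)) is a lower bound for the left side of
     [Hind]. *)
  assert (HN : INR N <= H (meet (agree (seq 0 N)) L)).
  { apply entR_discrete; [apply HA|]; intros x y Hx Hy HM.
    unfold meet in HM; apply andb_true_iff in HM; apply (agree_full N); tauto. }
  unfold positions; fold N; lra.
Qed.

Lemma entR_positions_le m n E : valid_graph m E ->
  sum (fun i => entR (all_bits (n * length E)) (agree (positions n E i))) (seq 0 m)
  <= 2 * INR (n * length E).
Proof.
  intros HE; transitivity (sum (fun i => INR (length (positions n E i))) (seq 0 m)).
  - apply sum_le; intros; apply entR_agree_le.
  - unfold positions; rewrite (sum_ext _ _ _ (fun i _ => count_sum _ _)), sum_swap.
    rewrite (sum_ext _ (fun _ => 2)).
    + rewrite sum_const, length_seq; lra.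
    + intros p Hp; apply in_seq in Hp.
      rewrite (sum_incident m E (p / n) 1 HE); [lra|apply div_edge_lt; lia].
Qed.

(* The sender of a transmission adds no entropy given its own observation, and for the
   other terminals conditioning reduces the entropy of the transmission. *)
Lemma interactive_entropy {T} (Om : list T) (o : nat -> T -> list bool) m steps acc :
  Forall (fun st => (fst st < m)%nat) steps ->
  let final := fun w => run steps (fun i => o i w) (acc w) in
  sum (fun i => entR Om (meet (ker eq_lb (o i)) (ker eq_ln final))
              - entR Om (meet (ker eq_lb (o i)) (ker eq_ln acc))) (seq 0 m)
  <= (INR m - 1) * (entR Om (ker eq_ln final) - entR Om (ker eq_ln acc)).
Proof.
  intros Hs; revert acc; induction Hs as [|[j g] steps Hj Hs IH]; intros acc; simpl.
  - change (fun w => acc w) with acc.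
    rewrite (sum_ext _ (fun _ => 0)) by (intros; lra); rewrite sum_const; lra.
  - set (acc' := fun w => acc w ++ [g (o j w) (acc w)]).
    specialize (IH acc'); cbv zeta in IH.
    set (fin := fun w => run steps (fun i => o i w) (acc' w)) in *.
    change (fun w => run steps (fun i => o i w) (acc w ++ [g (o j w) (acc w)])) with fin.
    set (d := entR Om (ker eq_ln acc') - entR Om (ker eq_ln acc)).
    assert (Hstep : sum (fun i => entR Om (meet (ker eq_lb (o i)) (ker eq_ln acc'))
        - entR Om (meet (ker eq_lb (o i)) (ker eq_ln acc))) (seq 0 m)
        <= sum (fun i => d - if Nat.eqb i j then d else 0) (seq 0 m)).
    { apply sum_le; intros i _; destruct (Nat.eqb_spec i j) as [->|_].
      - rewrite (entR_ext Om (meet (ker eq_lb (o j)) (ker eq_ln acc'))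
                             (meet (ker eq_lb (o j)) (ker eq_ln acc))); [lra|..].
        + apply equivb_meet; apply equivb_ker.
        + apply equivb_meet; apply equivb_ker.
        + intros x y _ _; unfold meet; rewrite !andb_true_iff, !kerP; unfold acc'.
          split; intros [E1 E2]; split; auto.
          * apply app_inj_tail in E2; tauto.
          * rewrite E1, E2; reflexivity.
      - assert (HC := entR_cond_le Om (ker eq_lb (o i)) (ker eq_ln acc') (ker eq_ln acc)
          (equivb_ker _ _) (equivb_ker _ _) (equivb_ker _ _)).
        unfold d; enough (Himp : forall x y, ker eq_ln acc' x y = true ->
          ker eq_ln acc x y = true) by (specialize (HC Himp); lra).
        intros x y; rewrite !kerP; intros E2; apply app_inj_tail in E2; tauto. }
    rewrite !sum_minus, sum_const, length_seq, sum_single in Hstep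
      by (try apply seq_NoDup; apply in_seq; simpl in Hj; lia).
    rewrite sum_minus in IH |- *; unfold d in Hstep; lra.
Qed.

(* Fano's inequality in the form H(K|Y) <= H(Z), where Z reveals the whole sample
   exactly when an error occurs. *)
Lemma fano {U} (eqd : forall x y : U, {x = y} + {x <> y}) N Y (K : list bool -> U) good :
  equivb Y ->
  (forall x y, good x = true -> good y = true -> Y x y = true -> K x = K y) ->
  entR (all_bits N) (meet Y (ker eqd K)) - entR (all_bits N) Y
  <= (1 - prob N good) * (INR N + / ln 2).
Proof.
  intros HY HK; set (Z := fun w => if good w then [] else true :: w).
  set (H := entR (all_bits N)); assert (HZe := equivb_ker eq_lb Z).
  assert (H1 : H (meet Y (ker eqd K)) <= H (meet Y (ker eq_lb Z))).
  { apply entR_le; [apply equivb_meet; assumption|]; intros x y _ _.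
    unfold meet; rewrite !andb_true_iff, !kerP; intros [HYxy HZ]; split; [assumption|].
    unfold Z in HZ; destruct (good x) eqn:Gx, (good y) eqn:Gy; try discriminate; auto.
    injection HZ as ->; reflexivity. }
  assert (H2 := entR_subadd (all_bits N) Y _ HY HZe).
  enough (H3 : H (ker eq_lb Z) <= (1 - prob N good) * (INR N + / ln 2))
    by (unfold H in *; lra).
  set (q := 2 ^ N); assert (Hq : 0 < q) by (apply pow_lt; lra).
  assert (0 < / q) by (apply Rinv_0_lt_compat; lra).
  assert (Hl2 : 0 < / ln 2) by (apply Rinv_0_lt_compat, ln2_pos).
  set (c := class_size (all_bits N) (ker eq_lb Z)).
  (* Pointwise bound: log x <= x - 1 on good samples, and at most N bits on bad ones. The good
     samples lie in one class, so their inverse class sizes sum to at most 1, and what remains is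
     proportional to the error probability. *)
  transitivity (sum (fun w => / ln 2 * (if good w then / c w else 0)
     - / ln 2 * / q * (if good w then 1 else 0)
     + INR N * / q * (1 - if good w then 1 else 0)) (all_bits N)).
  - apply sum_le; intros w Hw; rewrite INR_length_all_bits; fold q; fold (c w).
    assert (Hc := class_size_ge1 (all_bits N) (ker eq_lb Z) w HZe Hw); fold (c w) in Hc.
    rewrite log2_div by lra; unfold q at 2; rewrite log2_pow2.
    destruct (good w).
    + assert (HL := log2_le_sub1 (q / c w) ltac:(apply Rdiv_lt_0_compat; lra)).
      rewrite log2_div in HL by lra; unfold q at 1 in HL; rewrite log2_pow2 in HL.
      apply (Rmult_le_compat_l (/ q)) in HL; [|lra].
      replace (/ q * (/ ln 2 * (q / c w - 1))) with (/ ln 2 * / c w - / ln 2 * / q) in HL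
        by (field; repeat split; try lra; apply Rgt_not_eq, ln2_pos).
      lra.
    + assert (HL := log2_le 1 (c w) Rlt_0_1 Hc); rewrite log2_1 in HL; nra.
  - rewrite sum_plus, sum_minus, !sum_scal, sum_minus, sum_const, <- count_sum.
    unfold prob, Rdiv; rewrite !INR_length_all_bits; fold q.
    assert (HI := sum_inv_class (all_bits N) (ker eq_lb Z) good HZe).
    fold c in HI; set (g := INR (length (filter good (all_bits N)))).
    apply (Rmult_le_compat_l (/ ln 2)) in HI; [|lra|].
    + replace (INR N * / q * (q * 1 - g)) with (INR N * (1 - g * / q)) by (field; lra).
      lra.
    + intros x y Gx Gy; apply kerP; unfold Z; rewrite Gx, Gy; reflexivity.
Qed.

Lemma ent_le_log_card {T} (eqd : forall x y : T, {x = y} + {x <> y}) N f :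
  ent eqd N f <= log2 (INR (card_range eqd N f)).
Proof.
  apply entR_ker_le_log; [apply all_bits_nonempty|].
  intros w Hw; apply nodup_In, in_map, Hw.
Qed.

(* Counting each star twice in Shearer's inequality makes the terms H(X_i) cancel, so
   the bound involves neither the graph nor the secrecy capacity. *)
Lemma key_entropy_le_communication m n E F K J eps :
  (2 <= m)%nat -> valid_graph m E -> Forall (fun st => (fst st < m)%nat) F ->
  let N := (n * length E)%nat in
  let Ftr := transcript n E F in
  prob N (fun w => forallb (fun i => Nat.eqb (J i (obs n E i w) (Ftr w)) (K w)) (seq 0 m))
    >= 1 - eps ->
  mutinf Nat.eq_dec eq_ln N K Ftr <= eps ->
  (INR m - 2) * (ent Nat.eq_dec N K - eps) - INR m * (eps * (INR N + / ln 2))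
  <= ent eq_ln N Ftr.
Proof.
  intros Hm HE HF N Ftr Hprob Hmut.
  set (good := fun w => forallb _ _) in Hprob.
  set (H := entR (all_bits N)).
  set (kF := ker eq_ln Ftr); set (kK := ker Nat.eq_dec K).
  set (X := fun i => ker eq_lb (obs n E i)).
  assert (eF : equivb kF) by apply equivb_ker.
  assert (eK : equivb kK) by apply equivb_ker.
  assert (eX : forall i, equivb (X i)) by (intros; apply equivb_ker).
  assert (HXA : forall i r, equivb r ->
    H (meet (agree (positions n E i)) r) = H (meet (X i) r)).
  { intros i r Hr; apply entR_ext; try (apply equivb_meet; auto using equivb_agree).
    intros x y _ _; unfold meet, X; rewrite !andb_true_iff, kerP, obs_eq; tauto. }
  assert (Hfano : forall i, In i (seq 0 m) ->
     H (meet (X i) (meet kF kK)) <= H (meet (X i) kF) + eps * (INR N + / ln 2)).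
  { intros i Hi; unfold H.
    rewrite (entR_ext _ _ (meet (meet (X i) kF) kK)).
    - assert (HF' := fano Nat.eq_dec N (meet (X i) kF) K good (equivb_meet _ _ (eX i) eF)).
      assert (Hpos : 0 < / ln 2) by (apply Rinv_0_lt_compat, ln2_pos).
      assert (HN := pos_INR N).
      assert ((1 - prob N good) * (INR N + / ln 2) <= eps * (INR N + / ln 2))
        by (apply Rmult_le_compat_r; lra).
      enough (Hrec : forall x y, good x = true -> good y = true ->
         meet (X i) kF x y = true -> K x = K y)
        by (specialize (HF' Hrec); fold kK in HF'; lra).
      unfold good; intros x y; rewrite !forallb_forall; intros Gx Gy.
      specialize (Gx i Hi); specialize (Gy i Hi); apply Nat.eqb_eq in Gx, Gy.
      unfold meet, X, kF; rewrite andb_true_iff, !kerP; intros [E1 E2].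
      rewrite <- Gx, <- Gy, E1, E2; reflexivity.
    - auto using equivb_meet.
    - auto using equivb_meet.
    - intros x y _ _; unfold meet; rewrite !andb_true_iff; tauto. }
  assert (HS := shearer m n E (meet kF kK) HE (equivb_meet _ _ eF eK)); fold N H in HS.
  rewrite (sum_ext _ (fun i => H (meet (X i) (meet kF kK)))) in HS
    by (intros; apply HXA, equivb_meet; assumption).
  apply sum_le in Hfano; rewrite sum_plus, sum_const, length_seq in Hfano.
  assert (HI := interactive_entropy (all_bits N) (obs n E) m F (fun _ => []) HF).
  cbv zeta in HI; change (fun w => run F _ _) with Ftr in HI.
  fold kF H in HI; rewrite sum_minus in HI.
  assert (Hnil : forall r : list bool -> list bool -> bool, equivb r ->
     H (meet r (ker eq_ln (fun _ => []))) = H r).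
  { intros r Hr; apply entR_ext; auto using equivb_meet, equivb_ker.
    intros x y _ _; unfold meet; rewrite andb_true_iff, kerP; tauto. }
  assert (Hnil0 : H (ker eq_ln (fun _ => [])) = 0).
  { rewrite <- (entR_total (all_bits N)); apply entR_ext; auto using equivb_ker, equivb_total.
    intros x y _ _; rewrite kerP; unfold total; tauto. }
  rewrite Hnil0, (sum_ext (fun i => H (meet _ (ker eq_ln (fun _ => []))))
     (fun i => H (agree (positions n E i)))) in HI.
  2:{ intros i _; rewrite Hnil by apply equivb_ker.
      apply entR_ext; [apply equivb_ker|apply equivb_agree|].
      intros x y _ _; rewrite kerP; apply obs_eq. }
  assert (HP := entR_positions_le m n E HE); fold N H in HP.
  unfold mutinf in Hmut; rewrite !ent_entR in Hmut |- *; fold kF kK H in Hmut |- *.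
  rewrite ent_pair in Hmut; fold kF kK in Hmut.
  assert (HL : entR (all_bits N) (meet kK kF) = H (meet kF kK)).
  { apply entR_ext; auto using equivb_meet.
    intros x y _ _; unfold meet; rewrite !andb_true_iff; tauto. }
  rewrite HL in Hmut.
  assert (Hm2 : 0 <= INR m - 2) by (apply le_INR in Hm; simpl in Hm; lra).
  assert (Hmul : (INR m - 2) * (H kK + H kF - eps) <= (INR m - 2) * H (meet kF kK))
    by (apply Rmult_le_compat_l; lra).
  (* Shearer and Fano give 2N + (m-2) H(F,K) <= sum_i H(X_i,F) + m eps (N + 1/ln 2), and
     interactivity gives sum_i H(X_i,F) <= 2N + (m-1) H(F). Inserting H(F,K) >= H(F) + H(K) - eps
     leaves a single H(F) on the right. *)
  unfold X in *; lra.
Qed.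

Lemma SK_achievable_ge m E R0 : (2 <= m)%nat -> valid_graph m E ->
  SK_achievable m E R0 -> exists c, is_mmi m E c /\ (INR m - 2) * c <= R0.
Proof.
  intros Hm HE (c & Hc & Fs & Ks & Js & Hsend & Hach); exists c; split; [assumption|].
  (* [B] collects the coefficients of eps: 1 from the rate, m - 2 each from the key rate and the
     leakage, and the Fano terms. After division by n these are bounded uniformly, so one block
     length for each eps suffices. *)
  set (B := 1 + 2 * (INR m - 2) + INR m * (INR (length E) + / ln 2)).
  assert (Hpos : 0 < / ln 2) by (apply Rinv_0_lt_compat, ln2_pos).
  assert (Hm2 : 0 <= INR m - 2) by (apply le_INR in Hm; simpl in Hm; lra).
  assert (HEp := pos_INR (length E)).
  assert (HB : 0 < B) by (unfold B; nra).
  enough (Heps : forall eps, eps > 0 -> (INR m - 2) * c <= R0 + eps * B).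
  { apply le_epsilon; intros e He; specialize (Heps (e / B)).
    replace (e / B * B) with e in Heps by (field; lra).
    apply Heps, Rdiv_lt_0_compat; assumption. }
  intros eps Heps; destruct (Hach eps Heps) as (n0 & Hn0).
  set (n := Nat.max 1 n0).
  destruct (Hn0 n ltac:(lia) ltac:(lia)) as (Hrate & Hprob & Hmut & Hkey).
  assert (HC := key_entropy_le_communication m n E (Fs n) (Ks n) (Js n) eps Hm HE
                  (Hsend n) Hprob Hmut).
  assert (HF := ent_le_log_card eq_ln (n * length E) (transcript n E (Fs n))).
  assert (Hn : 1 <= INR n) by (change 1 with (INR 1); apply le_INR; lia).
  assert (0 < / INR n <= 1).
  { split; [apply Rinv_0_lt_compat; lra|]. rewrite <- Rinv_1; apply Rinv_le_contravar; lra. }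
  cbv zeta in HC; rewrite mult_INR in HC.
  apply (Rmult_le_compat_l (/ INR n)) in HC, HF; try lra.
  set (hK := ent _ _ (Ks n)) in *; set (hF := ent _ _ (transcript _ _ _)) in *.
  replace (/ INR n * ((INR m - 2) * (hK - eps)
             - INR m * (eps * (INR n * INR (length E) + / ln 2))))
    with ((INR m - 2) * (/ INR n * hK) - (INR m - 2) * eps * / INR n
       - INR m * eps * INR (length E) - INR m * eps * / ln 2 * / INR n) in HC
    by (field; split; [apply Rgt_not_eq, ln2_pos|lra]).
  assert ((INR m - 2) * (c - eps) <= (INR m - 2) * (/ INR n * hK))
    by (apply Rmult_le_compat_l; lra).
  assert ((INR m - 2) * eps * / INR n <= (INR m - 2) * eps * 1)
    by (apply Rmult_le_compat_l; nra).
  assert (INR m * eps * / ln 2 * / INR n <= INR m * eps * / ln 2 * 1)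
    by (apply Rmult_le_compat_l; [repeat apply Rmult_le_pos; try lra; apply pos_INR|lra]).
  unfold B; lra.
Qed.

(** * Multipartite information and omniscience *)

Lemma HX_sum E A :
  HX E A = sum (fun j => if touches A (edge_at E j) then 1 else 0) (seq 0 (length E)).
Proof. rewrite HX_touches; apply count_sum. Qed.

Lemma HX_ext E A B : (forall v, In v A <-> In v B) -> HX E A = HX E B.
Proof.
  intros H; rewrite !HX_sum; apply sum_ext; intros j _.
  replace (touches A (edge_at E j)) with (touches B (edge_at E j)); [reflexivity|].
  apply eq_true_iff_eq; rewrite !touchesP, !H; tauto.
Qed.

Lemma HX_all m E : valid_graph m E -> HX E (seq 0 m) = INR (length E).
Proof.
  intros HE; rewrite HX_sum, (sum_ext _ (fun _ => 1)).
  - rewrite sum_const, length_seq; lra.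
  - intros j Hj; apply in_seq in Hj.
    destruct (valid_edge m E j HE ltac:(lia)) as (H1 & _).
    replace (touches (seq 0 m) (edge_at E j)) with true; [reflexivity|].
    symmetry; apply touchesP; left; apply in_seq; lia.
Qed.

Lemma sum_HX_terminals m E : valid_graph m E ->
  sum (fun i => HX E [i]) (seq 0 m) = 2 * INR (length E).
Proof.
  intros HE; rewrite (sum_ext _ _ _ (fun i _ => HX_sum E [i])), sum_swap.
  rewrite (sum_ext _ (fun _ => 2)); [rewrite sum_const, length_seq; lra|].
  intros j Hj; apply in_seq in Hj.
  rewrite (sum_ext _ (fun i => if incident i (edge_at E j) then 1 else 0)).
  - rewrite (sum_incident m E j 1 HE); [lra|lia].
  - intros i _; unfold touches; simpl; rewrite orb_false_r; reflexivity.
Qed.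

Lemma Delta_singletons m E : (2 <= m)%nat -> valid_graph m E ->
  Delta m E (singletons m) = INR (length E) / (INR m - 1).
Proof.
  intros Hm HE; unfold Delta, singletons.
  rewrite length_map, length_seq, map_map, sum_HX_terminals, (HX_all m) by assumption.
  unfold Rdiv; lra.
Qed.

Lemma partition_In m P v : is_partition m P -> (v < m)%nat ->
  exists A, In A P /\ In v A.
Proof.
  intros [HP _] Hv; assert (Hin : In v (concat P)).
  { apply (Permutation_in v (Permutation_sym HP)), in_seq; lia. }
  apply in_concat in Hin; destruct Hin as (A & ? & ?); eauto.
Qed.

Lemma Delta_nonneg m E P : valid_graph m E -> is_partition m P ->
  (2 <= length P)%nat -> 0 <= Delta m E P.
Proof.
  intros HE HP Hk; apply le_INR in Hk; simpl in Hk; unfold Delta.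
  apply Rmult_le_pos; [left; apply Rinv_0_lt_compat; lra|].
  rewrite (HX_all m) by assumption.
  rewrite (sum_ext _ _ _ (fun A _ => HX_sum E A)), sum_swap.
  enough (Hge : INR (length E) <= sum (fun j => sum (fun A =>
    if touches A (edge_at E j) then 1 else 0) P) (seq 0 (length E))) by lra.
  rewrite <- (length_seq (length E) 0) at 1.
  rewrite <- (Rmult_1_r (INR _)), <- sum_const; apply sum_le; intros j Hj.
  apply in_seq in Hj; destruct (valid_edge m E j HE ltac:(lia)) as (H1 & _).
  destruct (partition_In m P _ HP H1) as (A & HA & Hv).
  transitivity (sum (fun A => if touches A (edge_at E j) then 1 else 0) [A]).
  - simpl; replace (touches A (edge_at E j)) with true; [lra|].
    symmetry; apply touchesP; auto.
  - apply sum_NoDup_incl; [repeat constructor; auto|intros ? [<-|[]]; assumption|].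
    intros B _; destruct (touches B _); lra.
Qed.

Lemma mmi_nonneg m E c : valid_graph m E -> is_mmi m E c -> 0 <= c.
Proof. intros HE ((P & HP & Hk & <-) & _); apply Delta_nonneg; assumption. Qed.

Lemma filter_complement_sum {T} (f : T -> R) (B : T -> bool) l :
  sum f (filter B l) = sum f l - sum f (filter (fun x => negb (B x)) l).
Proof.
  rewrite !sum_filter, <- sum_minus; apply sum_ext; intros x _.
  destruct (B x); simpl; lra.
Qed.

Definition memb (A : list nat) (i : nat) : bool := existsb (Nat.eqb i) A.

Lemma membP A i : memb A i = true <-> In i A.
Proof.
  unfold memb; rewrite existsb_exists; split.
  - intros (x & Hx & E); apply Nat.eqb_eq in E; subst; assumption.
  - intros Hi; exists i; rewrite Nat.eqb_refl; auto.
Qed.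

Lemma NoDup_app_disjoint {T} (l l' : list T) x :
  NoDup (l ++ l') -> In x l -> ~ In x l'.
Proof.
  induction l as [|a l IH]; simpl; [tauto|]; intros H; inversion H; subst.
  intros [->|Hx]; [|auto]; rewrite in_app_iff in *; tauto.
Qed.

(** A cell is nonempty and proper, so its complement is an admissible set for [CO_feasible].
    Properness comes from a second cell, which is nonempty and disjoint from the first. *)
Lemma partition_cell m P A : is_partition m P -> (2 <= length P)%nat -> In A P ->
  (exists i, In i A) /\ (exists i, (i < m)%nat /\ ~ In i A) /\
  (forall i, In i A -> (i < m)%nat) /\ NoDup A.
Proof.
  intros [HP Hne] Hk HA; rewrite Forall_forall in Hne.
  assert (Hnd : NoDup (concat P))
    by (eapply Permutation_NoDup; [apply Permutation_sym, HP|apply seq_NoDup]).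
  assert (Hlt : forall B i, In B P -> In i B -> (i < m)%nat).
  { intros B i HB Hi; enough (In i (seq 0 m)) as H by (apply in_seq in H; lia).
    eapply Permutation_in; [exact HP|]; apply in_concat; eauto. }
  assert (Hpick : forall B, In B P -> exists i, In i B).
  { intros [|i B] HB; [destruct (Hne _ HB eq_refl)|exists i; simpl; auto]. }
  destruct (in_split A P HA) as (l1 & l2 & ->).
  assert (HNA : NoDup (A ++ concat (l1 ++ l2))).
  { eapply Permutation_NoDup; [|exact Hnd].
    rewrite !concat_app; simpl; rewrite !app_assoc.
    apply Permutation_app_tail, Permutation_app_comm. }
  repeat split; [auto| |eauto|].
  - destruct (l1 ++ l2) as [|A' l] eqn:El.
    + rewrite length_app in Hk; apply (f_equal (@length _)) in El.
      rewrite length_app in El; simpl in *; lia.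
    + assert (HA' : In A' (l1 ++ A :: l2)).
      { assert (In A' (l1 ++ l2)) as H by (rewrite El; simpl; auto).
        rewrite in_app_iff in H |- *; simpl; tauto. }
      destruct (Hpick A' HA') as (i & Hi); exists i; split; [eauto|]; intros HiA.
      apply (NoDup_app_disjoint _ _ i HNA HiA).
      simpl; rewrite in_app_iff; auto.
  - eapply NoDup_app_remove_r; exact HNA.
Qed.

(* Summing the constraints for the complements of the cells. *)
Lemma omniscience_ge m E P Rt : valid_graph m E -> is_partition m P ->
  (2 <= length P)%nat -> CO_feasible m E Rt ->
  INR (length E) - Delta m E P <= sum Rt (seq 0 m).
Proof.
  intros HE HP Hk HCO; set (tot := sum Rt (seq 0 m)).
  assert (Hcell : forall A, In A P -> INR (length E) - HX E A <= tot - sum Rt A).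
  { intros A HA; destruct (partition_cell m P A HP Hk HA)
      as ((i & Hi) & (o & Ho & HoA) & Hlt & Hnd).
    (* The complement of the cell: the entropy subtracted in the constraint is then that of [A]. *)
    set (B := fun i => negb (memb A i)).
    assert (HB : forall v, In v (filter (fun i => negb (B i)) (seq 0 m)) <-> In v A).
    { intros v; unfold B; rewrite filter_In, negb_involutive, membP, in_seq.
      split; [tauto|]; intros Hv; specialize (Hlt v Hv); split; [lia|assumption]. }
    assert (HC : sum Rt (filter B (seq 0 m)) >= HX E (seq 0 m)
                 - HX E (filter (fun i => negb (B i)) (seq 0 m))).
    { apply HCO.
      - exists o; split; [assumption|]; unfold B.
        rewrite negb_true_iff, <- not_true_iff_false, membP; assumption.
      - exists i; split; [auto|]; unfold B; rewrite negb_false_iff, membP; assumption. }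
    rewrite (HX_all m), (HX_ext E _ A), filter_complement_sum in HC by assumption.
    fold tot in HC; rewrite (sum_perm Rt _ A) in HC; [lra|].
    apply NoDup_Permutation; [apply NoDup_filter, seq_NoDup|assumption|assumption]. }
  (* Over k cells the total rate occurs k times and the rates of the cells remove it once; the
     entropies give (k - 1) (|E| - Delta(P)) on the other side. *)
  apply sum_le in Hcell; rewrite !sum_minus, !sum_const, <- sum_concat in Hcell.
  rewrite (sum_perm Rt _ _ (proj1 HP)) in Hcell; fold tot in Hcell.
  unfold Delta; rewrite (HX_all m) by assumption.
  apply le_INR in Hk; simpl in Hk; set (k := INR (length P)) in *.
  apply Rmult_le_reg_l with (k - 1); [lra|].
  rewrite Rmult_minus_distr_l, <- Rmult_assoc, Rinv_r by lra.
  set (hs := sum (HX E) P) in *; change (sum (fun x => HX E x) P) with hs in Hcell; lra.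
Qed.

(** The complement of [B] is one cell and [B] is split into points. As |P| - 1 = |B|, a lower bound
    on [Delta] of this partition is an omniscience constraint for [B]. *)
Lemma singletons_split_partition m (B : nat -> bool) :
  (exists i, (i < m)%nat /\ B i = false) ->
  is_partition m (filter (fun i => negb (B i)) (seq 0 m)
                  :: map (fun i => [i]) (filter B (seq 0 m))).
Proof.
  intros (o & Ho & HBo); split.
  - simpl; assert (Hc : forall l : list nat, concat (map (fun i => [i]) l) = l)
      by (induction l; simpl; congruence).
    rewrite Hc; apply NoDup_Permutation.
    + apply NoDup_app; try apply NoDup_filter, seq_NoDup.
      intros i; rewrite !filter_In, negb_true_iff; intros [_ ->] [_ ?]; discriminate.
    + apply seq_NoDup.
    + intros i; rewrite in_app_iff, !filter_In; destruct (B i); simpl; intuition discriminate.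
  - constructor.
    + intros E0; assert (Hin : In o (filter (fun i => negb (B i)) (seq 0 m))).
      { apply filter_In; rewrite HBo; split; [apply in_seq; lia|reflexivity]. }
      rewrite E0 in Hin; destruct Hin.
    + apply Forall_map, Forall_forall; discriminate.
Qed.

Lemma singletons_partition m : is_partition m (singletons m).
Proof.
  split.
  - unfold singletons; assert (Hc : forall l : list nat, concat (map (fun i => [i]) l) = l)
      by (induction l; simpl; congruence).
    rewrite Hc; reflexivity.
  - apply Forall_map, Forall_forall; discriminate.
Qed.

Lemma typeS_mmi m E : (2 <= m)%nat -> valid_graph m E -> typeS m E ->
  is_mmi m E (INR (length E) / (INR m - 1)).
Proof.
  intros Hm HE HS; rewrite <- Delta_singletons by assumption; split; [|exact HS].
  exists (singletons m); split; [apply singletons_partition|].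
  unfold singletons; rewrite length_map, length_seq; auto.
Qed.

Lemma typeS_RCO m E : (2 <= m)%nat -> valid_graph m E -> typeS m E ->
  is_RCO m E (INR (length E) - INR (length E) / (INR m - 1)).
Proof.
  intros Hm HE HS; assert (Hm1 := le_INR _ _ Hm); simpl in Hm1.
  set (c := INR (length E) / (INR m - 1)).
  assert (Hc : Delta m E (singletons m) = c) by (apply Delta_singletons; assumption).
  split.
  (* The inequality c <= Delta(P) for the partition above, multiplied by |B|, is the constraint of
     [B] for these rates. Their total is 2|E| - m c = |E| - c, because |E| = (m - 1) c. *)
  - exists (fun i => HX E [i] - c); split.
    + intros B (i & Hi & HBi) HBo.
      set (P := filter (fun i => negb (B i)) (seq 0 m)
                :: map (fun i => [i]) (filter B (seq 0 m))).
      assert (Hin : In i (filter B (seq 0 m)))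
        by (apply filter_In; split; [apply in_seq; lia|assumption]).
      assert (Hb : (1 <= length (filter B (seq 0 m)))%nat)
        by (destruct (filter B (seq 0 m)); [destruct Hin|simpl; lia]).
      assert (HD : Delta m E (singletons m) <= Delta m E P).
      { apply HS; [apply singletons_split_partition, HBo|].
        unfold P; simpl; rewrite length_map; lia. }
      rewrite Hc in HD; unfold Delta, P in HD; cbn [length] in HD.
      rewrite length_map, S_INR in HD; cbn [map] in HD; rewrite map_map in HD.
      rewrite sum_minus, sum_const.
      apply le_INR in Hb; simpl in Hb; set (b := INR (length (filter B (seq 0 m)))) in *.
      cbn [Rsum fold_right] in HD.
      change (fold_right Rplus 0) with Rsum in HD.
      apply (Rmult_le_compat_l b) in HD; [|lra].
      replace (b + 1 - 1) with b in HD by ring.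
      rewrite <- Rmult_assoc, Rinv_r, Rmult_1_l in HD by lra; lra.
    + rewrite sum_minus, sum_const, length_seq, sum_HX_terminals by assumption.
      unfold c; field; lra.
  - intros Rt HRt; rewrite <- Hc; apply omniscience_ge; auto.
    + apply singletons_partition.
    + unfold singletons; rewrite length_map, length_seq; assumption.
Qed.

(** * Cuts of a vertex partition *)

Definition parts (m : nat) (comp : nat -> nat) : nat :=
  length (nodup Nat.eq_dec (map comp (seq 0 m))).

Definition cross (comp : nat -> nat) (e : nat * nat) : bool :=
  negb (Nat.eqb (comp (fst e)) (comp (snd e))).

Lemma label_partition m comp :
  is_partition m (map (fun l => filter (fun v => Nat.eqb (comp v) l) (seq 0 m))
                      (nodup Nat.eq_dec (map comp (seq 0 m)))).
Proof.
  split.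
  - apply NoDup_Permutation; [|apply seq_NoDup|].
    + generalize (NoDup_nodup Nat.eq_dec (map comp (seq 0 m))).
      generalize (nodup Nat.eq_dec (map comp (seq 0 m))) as L.
      induction 1 as [|l L Hl HL IH]; simpl; [constructor|].
      apply NoDup_app; [apply NoDup_filter, seq_NoDup|assumption|].
      intros v Hv Hc; apply filter_In in Hv; destruct Hv as [_ Hv].
      apply Nat.eqb_eq in Hv; subst l.
      rewrite <- flat_map_concat_map in Hc; apply in_flat_map in Hc.
      destruct Hc as (l & Hl' & Hv); apply filter_In in Hv; destruct Hv as [_ Hv].
      apply Nat.eqb_eq in Hv; congruence.
    + intros v; rewrite <- flat_map_concat_map, in_flat_map; split.
      * intros (l & _ & Hv); apply filter_In in Hv; tauto.
      * intros Hv; exists (comp v); split; [apply nodup_In, in_map, Hv|].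
        apply filter_In; rewrite Nat.eqb_refl; auto.
  - apply Forall_map, Forall_forall; intros l Hl E0.
    apply nodup_In, in_map_iff in Hl; destruct Hl as (v & <- & Hv).
    assert (Hin : In v (filter (fun u => Nat.eqb (comp u) (comp v)) (seq 0 m)))
      by (apply filter_In; rewrite Nat.eqb_refl; auto).
    rewrite E0 in Hin; destruct Hin.
Qed.

(** In the sum of H(X_A) over the cells a crossing edge counts twice and any other edge once, so (k
    - 1) Delta(P) is the number of crossing edges. A labelling with at most one class is no
    partition for [is_mmi], but then the left side is nonpositive. *)
Lemma mmi_cut m E c comp : valid_graph m E -> is_mmi m E c ->
  c * (INR (parts m comp) - 1) <=
  sum (fun j => if cross comp (edge_at E j) then 1 else 0) (seq 0 (length E)).
Proof.
  intros HE Hc; assert (Hc0 := mmi_nonneg m E c HE Hc).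
  set (L := nodup Nat.eq_dec (map comp (seq 0 m))).
  destruct (le_lt_dec 2 (parts m comp)) as [Hk|Hk].
  - assert (HD := proj2 Hc _ (label_partition m comp)).
    rewrite length_map in HD; specialize (HD Hk); unfold Delta in HD.
    rewrite length_map, (HX_all m), map_map in HD by assumption.
    fold L in HD; fold (parts m comp) in HD.
    change (length L) with (parts m comp) in HD.
    apply le_INR in Hk; simpl in Hk.
    apply (Rmult_le_compat_l (INR (parts m comp) - 1)) in HD; [|lra].
    rewrite <- Rmult_assoc, Rinv_r, Rmult_1_l in HD by lra.
    rewrite Rmult_comm; eapply Rle_trans; [exact HD|].
    rewrite (sum_ext _ _ _ (fun l _ => HX_sum E _)), sum_swap.
    enough (Hge : sum (fun j => sum (fun l =>
        if touches (filter (fun v => Nat.eqb (comp v) l) (seq 0 m)) (edge_at E j)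
        then 1 else 0) L) (seq 0 (length E))
      <= sum (fun j => 1 + if cross comp (edge_at E j) then 1 else 0) (seq 0 (length E)))
      by (rewrite sum_plus, sum_const, length_seq in Hge; lra).
    apply sum_le; intros j Hj; apply in_seq in Hj.
    destruct (valid_edge m E j HE ltac:(lia)) as (H1 & H2 & _).
    set (e := edge_at E j) in *.
    assert (HL : forall v, (v < m)%nat -> In (comp v) L)
      by (intros; apply nodup_In, in_map, in_seq; lia).
    (* Only the cells of the two endpoints are touched; the second is counted only if it differs
       from the first. *)
    transitivity (sum (fun l => (if Nat.eqb l (comp (fst e)) then 1 else 0) +
      (if Nat.eqb l (comp (snd e)) then if cross comp e then 1 else 0 else 0)) L).
    + apply sum_le; intros l _.
      destruct (touches _ e) eqn:Ht.
      * apply touchesP in Ht; rewrite !filter_In, !Nat.eqb_eq in Ht.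
        unfold cross; destruct Ht as [[_ <-]|[_ <-]].
        -- rewrite Nat.eqb_refl; destruct (Nat.eqb (comp (fst e)) (comp (snd e))); simpl; lra.
        -- rewrite Nat.eqb_refl, (Nat.eqb_sym (comp (snd e))).
           destruct (Nat.eqb _ _); simpl; lra.
      * destruct (Nat.eqb l (comp (fst e))), (Nat.eqb l (comp (snd e))), (cross comp e); lra.
    + rewrite sum_plus, !sum_single by (auto; apply NoDup_nodup); lra.
  - apply Rle_trans with 0.
    + assert (H1 : INR (parts m comp) <= INR 1) by (apply le_INR; lia); simpl in H1; nra.
    + apply sum_nonneg; intros; destruct (cross comp _); lra.
Qed.

(** * Spanning trees and tree packing *)

Lemma min_element {T} (w : T -> R) l : l <> [] ->
  exists x l', Permutation l (x :: l') /\ forall y, In y l -> w x <= w y.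
Proof.
  induction l as [|a l IH]; [congruence|]; intros _.
  destruct l as [|b l].
  - exists a, []; split; [reflexivity|]; intros y [<-|[]]; lra.
  - destruct IH as (x & l' & HP & Hx); [discriminate|].
    destruct (Rle_lt_dec (w a) (w x)) as [Hax|Hax].
    + exists a, (b :: l); split; [reflexivity|].
      intros y [<-|Hy]; [lra|]; specialize (Hx y Hy); lra.
    + exists x, (a :: l'); split.
      * rewrite HP; constructor.
      * intros y [<-|Hy]; [lra|auto].
Qed.

(** Connectivity of the graph whose vertices are the classes of [comp], stated by cuts so that no
    paths are needed: [S] ranges over the proper nonempty unions of classes. *)
Definition connects (m : nat) (E : list (nat * nat)) (comp : nat -> nat) (F : list nat) :=
  forall S : nat -> bool,
    (forall u v, comp u = comp v -> S u = S v) ->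
    (exists u, (u < m)%nat /\ S u = true) -> (exists v, (v < m)%nat /\ S v = false) ->
    exists j, In j F /\ S (fst (edge_at E j)) <> S (snd (edge_at E j)).

Definition merge (comp : nat -> nat) (e : nat * nat) (v : nat) : nat :=
  if Nat.eqb (comp v) (comp (snd e)) then comp (fst e) else comp v.

Lemma parts_merge m comp e : (fst e < m)%nat -> (snd e < m)%nat ->
  cross comp e = true -> (parts m (merge comp e) + 1 <= parts m comp)%nat.
Proof.
  unfold cross; rewrite negb_true_iff, Nat.eqb_neq; intros H1 H2 Hne.
  unfold parts; rewrite Nat.add_comm.
  apply (NoDup_incl_length
    (l := comp (snd e) :: nodup Nat.eq_dec (map (merge comp e) (seq 0 m)))).
  - constructor; [|apply NoDup_nodup].
    rewrite nodup_In, in_map_iff; intros (v & Hv & _); unfold merge in Hv.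
    destruct (Nat.eqb_spec (comp v) (comp (snd e))); congruence.
  - intros l; rewrite nodup_In; intros [<-|Hl]; [apply in_map, in_seq; lia|].
    rewrite nodup_In, in_map_iff in Hl; destruct Hl as (v & <- & Hv).
    unfold merge; destruct (Nat.eqb _ _); [apply in_map, in_seq; lia|apply in_map, Hv].
Qed.

Lemma parts_pos m comp : (1 <= m)%nat -> (1 <= parts m comp)%nat.
Proof.
  intros Hm; apply (NoDup_incl_length (l := [comp 0%nat])).
  - repeat constructor; auto.
  - intros l [<-|[]]; apply nodup_In, in_map, in_seq; lia.
Qed.

(* Kruskal's algorithm.  Lowering all weights by [a] compares weights layer by layer:
   the layer between [a] and the least weight contributes [c * length F <= length l]. *)
Lemma greedy_tree m E c w l comp a :
  (1 <= m)%nat -> valid_graph m E -> 0 < c ->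
  NoDup l -> (forall j, In j l -> (j < length E)%nat) -> (forall j, In j l -> a <= w j) ->
  (forall comp', (forall u v, comp u = comp v -> comp' u = comp' v) ->
     c * (INR (parts m comp') - 1) <=
     sum (fun j => if cross comp' (edge_at E j) then 1 else 0) l) ->
  exists F, NoDup F /\ incl F l /\ connects m E comp F /\
    (length F + 1 <= parts m comp)%nat /\
    c * sum (fun j => w j - a) F <= sum (fun j => w j - a) l.
Proof.
  intros Hm HE Hc; remember (length l) as k eqn:Hk.
  revert l Hk comp a; induction k as [|k IH]; intros l Hk comp a Hnd Hl Ha Hcut.
  - destruct l; [|discriminate]; exists []; split; [constructor|].
    assert (H1 := parts_pos m comp Hm); repeat split; [intros ? []| |simpl; lia|simpl; lra].
    (* With no edge left the cut condition reads c (k - 1) <= 0, so there is a single class and no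
       such [S]. *)
    intros S HS (u & Hu & HSu) (v & Hv & HSv); exfalso.
    assert (H2 : (2 <= parts m comp)%nat).
    { apply (NoDup_incl_length (l := [comp u; comp v])).
      - repeat constructor; simpl; intuition auto.
        rewrite (HS u v) in HSu by auto; congruence.
      - intros x [<-|[<-|[]]]; apply nodup_In, in_map, in_seq; lia. }
    specialize (Hcut comp (fun _ _ H => H)); simpl in Hcut.
    apply le_INR in H2; simpl in H2; nra.
  - destruct (min_element w l) as (x & l' & HP & Hx); [destruct l; discriminate|].
    assert (Hin : forall j, In j l <-> x = j \/ In j l').
    { intros j; split; intros Hj; [exact (Permutation_in j HP Hj)|].
      exact (Permutation_in j (Permutation_sym HP) Hj). }
    assert (Hnd' : NoDup (x :: l')) by (eapply Permutation_NoDup; eassumption).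
    inversion Hnd' as [|x0 l0 Hx' Hndl' Heq]; subst x0 l0.
    assert (Hk' : k = length l').
    { apply Permutation_length in HP; simpl in HP; lia. }
    assert (Hax : a <= w x) by (apply Ha, Hin; auto).
    set (e := edge_at E x).
    destruct (valid_edge m E x HE (Hl x (proj2 (Hin x) (or_introl eq_refl))))
      as (He1 & He2 & _).
    (* Measuring weights from [a] instead of [w x] adds w x - a for each edge, on both sides; |F| <=
       k - 1 and the cut condition at [comp] itself give c |F| <= |l|. *)
    assert (Hlayer : forall F, (length F + 1 <= parts m comp)%nat ->
      c * sum (fun j => w j - w x) F <= sum (fun j => w j - w x) l ->
      c * sum (fun j => w j - a) F <= sum (fun j => w j - a) l).
    { intros F HF HFw; apply le_INR in HF; rewrite plus_INR in HF; simpl in HF.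
      specialize (Hcut comp (fun _ _ H => H)).
      assert (Hcr : sum (fun j => if cross comp (edge_at E j) then 1 else 0) l
                    <= INR (length l)).
      { rewrite <- (Rmult_1_r (INR _)), <- sum_const; apply sum_le; intros j _.
        destruct (cross comp _); lra. }
      rewrite !sum_minus, !sum_const in HFw |- *.
      assert (c * INR (length F) <= INR (length l)) by nra.
      assert ((w x - a) * (c * INR (length F)) <= (w x - a) * INR (length l))
        by (apply Rmult_le_compat_l; lra).
      lra. }
    assert (Hsuml : sum (fun j => w j - w x) l = sum (fun j => w j - w x) l').
    { rewrite (sum_perm _ _ _ HP); simpl; lra. }
    destruct (cross comp e) eqn:Hcr.
    (* Select [x] and contract it. Measured from [w x] it has weight zero, and no coarsening of the
       merged labelling is crossed by it, so the cut condition survives its removal. *)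
    + destruct (IH l' Hk' (merge comp e) (w x)) as (F & HF1 & HF2 & HF3 & HF4 & HF5).
      * assumption.
      * intros j Hj; apply Hl, Hin; auto.
      * intros j Hj; apply Hx, Hin; auto.
      * intros comp' Hcomp'; eapply Rle_trans; [apply (Hcut comp')|].
        -- intros u v Huv; apply Hcomp'; unfold merge; rewrite Huv; reflexivity.
        -- rewrite (sum_perm _ _ _ HP); simpl; unfold cross at 1.
           rewrite (Hcomp' (fst (edge_at E x)) (snd (edge_at E x))).
           ++ rewrite Nat.eqb_refl; simpl; lra.
           ++ unfold merge; fold e; rewrite Nat.eqb_refl.
              destruct (Nat.eqb _ _); reflexivity.
      * exists (x :: F); split; [constructor; auto|].
        assert (Hpm := parts_merge m comp e He1 He2 Hcr).
        assert (Hlen : (length (x :: F) + 1 <= parts m comp)%nat) by (simpl; lia).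
        repeat split.
        -- intros j [<-|Hj]; apply Hin; auto.
        -- intros S HS Hu Hv.
           destruct (bool_dec (S (fst e)) (S (snd e))) as [Heq|Hne].
           ++ destruct (HF3 S) as (j & Hj & HSj); auto.
              ** intros u v; unfold merge.
                 destruct (Nat.eqb_spec (comp u) (comp (snd e))) as [E1|E1];
                 destruct (Nat.eqb_spec (comp v) (comp (snd e))) as [E2|E2];
                 intros E3; auto.
                 --- apply HS; congruence.
                 --- rewrite (HS _ _ E1), <- Heq; auto.
                 --- rewrite (HS _ _ E2), <- Heq; auto.
              ** exists j; simpl; auto.
           ++ exists x; simpl; auto.
        -- assumption.
        -- apply Hlayer; [assumption|]; simpl; rewrite Hsuml; lra.
    (* Here [x] joins vertices with equal labels; no coarsening is crossed by it, and it is
       discarded. *)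
    + destruct (IH l' Hk' comp (w x)) as (F & HF1 & HF2 & HF3 & HF4 & HF5).
      * assumption.
      * intros j Hj; apply Hl, Hin; auto.
      * intros j Hj; apply Hx, Hin; auto.
      * intros comp' Hcomp'; eapply Rle_trans; [apply (Hcut comp'), Hcomp'|].
        rewrite (sum_perm _ _ _ HP); simpl; unfold cross at 1.
        rewrite (Hcomp' (fst (edge_at E x)) (snd (edge_at E x))).
        -- rewrite Nat.eqb_refl; simpl; lra.
        -- unfold cross in Hcr; apply negb_false_iff, Nat.eqb_eq in Hcr; exact Hcr.
      * exists F; repeat split; auto.
        -- intros j Hj; apply Hin; auto.
        -- apply Hlayer; [assumption|]; rewrite Hsuml; assumption.
Qed.

(* A tree is a root edge together with steps [(v, (p, j))], the latest first: the edge
   [j] is attached at the vertex [v] to the edge [p], which is already in the tree. *)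
Definition tree : Type := nat * list (nat * (nat * nat)).

Definition tree_edges (t : tree) : list nat :=
  fst t :: map (fun s => snd (snd s)) (snd t).

(** The vertex [v] sees both edges [p] and [j] and can broadcast the sum of their bits, so a step is
    one transmission. Incidence is a parameter because the edges are first indices in [E] and later
    positions in the sample. *)
Fixpoint attached (inc : nat -> nat -> bool) (r : nat) (s : list (nat * (nat * nat))) : Prop :=
  match s with
  | [] => True
  | (v, (p, j)) :: s' =>
      inc v p = true /\ inc v j = true /\ In p (tree_edges (r, s')) /\ attached inc r s'
  end.

(** A root and m - 2 steps are m - 1 distinct edges covering all m vertices, each attached to an
    earlier one. *)
Definition spanning_tree (m : nat) (E : list (nat * nat)) (t : tree) : Prop :=
  NoDup (tree_edges t) /\
  (forall j, In j (tree_edges t) -> (j < length E)%nat) /\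
  attached (fun v j => incident v (edge_at E j)) (fst t) (snd t) /\
  (length (snd t) + 2 = m)%nat /\
  (forall s, In s (snd t) -> (fst s < m)%nat) /\
  (forall v, (v < m)%nat ->
     exists j, In j (tree_edges t) /\ incident v (edge_at E j) = true).

(* Prim's algorithm inside a connecting edge set. *)
Lemma connects_spanning_tree m E F :
  (2 <= m)%nat -> valid_graph m E -> (forall j, In j F -> (j < length E)%nat) ->
  connects m E (fun v => v) F ->
  exists t, spanning_tree m E t /\ incl (tree_edges t) F.
Proof.
  intros Hm HE HF Hcon.
  set (inc := fun v j => incident v (edge_at E j)).
  (* The root edge covers two vertices and each step one more, whence the k + 2 vertices in [V]. *)
  assert (Hgrow : forall k, (k + 2 <= m)%nat -> exists t V,
    NoDup (tree_edges t) /\ incl (tree_edges t) F /\ attached inc (fst t) (snd t) /\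
    length (snd t) = k /\ (forall s, In s (snd t) -> (fst s < m)%nat) /\
    NoDup V /\ length V = (k + 2)%nat /\ incl V (seq 0 m) /\
    (forall v, In v V -> exists j, In j (tree_edges t) /\ inc v j = true) /\
    (forall j, In j (tree_edges t) ->
       In (fst (edge_at E j)) V /\ In (snd (edge_at E j)) V)).
  { induction k as [|k IH]; intros Hk.
    - destruct (Hcon (fun v => Nat.eqb v 0)) as (j & Hj & _).
      + congruence.
      + exists 0%nat; split; [lia|reflexivity].
      + exists 1%nat; split; [lia|reflexivity].
      + destruct (valid_edge m E j HE (HF j Hj)) as (H1 & H2 & H3).
        exists (j, []), [fst (edge_at E j); snd (edge_at E j)].
        unfold tree_edges; simpl; repeat split; try tauto.
        * repeat constructor; auto.
        * intros x [<-|[]]; assumption.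
        * repeat constructor; simpl; intuition auto.
        * intros x [<-|[<-|[]]]; apply in_seq; lia.
        * intros v Hv; exists j; split; [auto|]; apply incidentP.
          destruct Hv as [<-|[<-|[]]]; auto.
        * destruct H as [<-|[]]; auto.
        * destruct H as [<-|[]]; auto.
    - destruct IH as (t & V & HN & HI & HA & HL & HS & HV & HVl & HVm & Hcov & Hend);
        [lia|].
      (* An edge leaving [V]. Its inner endpoint [u] already lies on some tree edge [p], where the
         new edge [j] is attached; the outer endpoint shows that [j] is new. *)
      destruct (Hcon (memb V)) as (j & Hj & HSj).
      + congruence.
      + destruct V as [|u V]; [simpl in HVl; lia|]; exists u; split.
        * assert (Hu := HVm u (or_introl eq_refl)); apply in_seq in Hu; lia.
        * apply membP; simpl; auto.
      + apply NNPP; intros Hno; assert (Hincl : incl (seq 0 m) V).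
        { intros v Hv; apply membP; apply NNPP; intros Hf; apply Hno; exists v.
          apply in_seq in Hv; split; [lia|]; apply not_true_is_false; assumption. }
        apply NoDup_incl_length in Hincl; [|apply seq_NoDup].
        rewrite length_seq in Hincl; lia.
      + destruct (valid_edge m E j HE (HF j Hj)) as (H1 & H2 & H3).
        assert (Huv : exists u v, In u V /\ ~ In v V /\ (u < m)%nat /\ (v < m)%nat /\
          inc u j = true /\ inc v j = true /\
          (forall x, x = fst (edge_at E j) \/ x = snd (edge_at E j) -> x = u \/ x = v)).
        { unfold inc; destruct (memb V (fst (edge_at E j))) eqn:M1;
            destruct (memb V (snd (edge_at E j))) eqn:M2; try congruence.
          - apply membP in M1; apply not_true_iff_false in M2; rewrite membP in M2.
            exists (fst (edge_at E j)), (snd (edge_at E j)).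
            rewrite !incidentP; repeat split; tauto.
          - apply membP in M2; apply not_true_iff_false in M1; rewrite membP in M1.
            exists (snd (edge_at E j)), (fst (edge_at E j)).
            rewrite !incidentP; repeat split; tauto. }
        destruct Huv as (u & v & Hu & Hv & Hum & Hvm & Huj & Hvj & Hends).
        destruct (Hcov u Hu) as (p & Hp & Hup).
        destruct t as [r s]; exists (r, (u, (p, j)) :: s), (v :: V).
        assert (Hte : forall x, In x (tree_edges (r, (u, (p, j)) :: s)) <->
                       x = j \/ In x (tree_edges (r, s)))
          by (intros x; unfold tree_edges; simpl; intuition auto).
        assert (Hjnew : ~ In j (tree_edges (r, s))).
        { intros Hjt; destruct (Hend j Hjt) as [E1 E2]; apply Hv.
          apply incidentP in Hvj; destruct Hvj as [-> | ->]; assumption. }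
        simpl in HL; repeat split; cbn [length snd]; auto.
        * apply NoDup_cons_iff in HN; destruct HN as [Hr HN].
          unfold tree_edges in Hjnew |- *; simpl in *.
          constructor; [simpl; intros [<-|?]; tauto|constructor; tauto].
        * intros x Hx; apply Hte in Hx; destruct Hx as [->|Hx]; auto.
        * intros st [<-|Hst]; [assumption|apply HS; assumption].
        * constructor; assumption.
        * lia.
        * intros x [<-|Hx]; [apply in_seq; lia|auto].
        * intros x [<-|Hx].
          -- exists j; rewrite Hte; auto.
          -- destruct (Hcov x Hx) as (y & Hy & Hxy); exists y; rewrite Hte; auto.
        * apply Hte in H; destruct H as [->|Hx].
          -- destruct (Hends (fst (edge_at E j)) (or_introl eq_refl)) as [-> | ->];
             simpl; auto.
          -- right; apply Hend; assumption.
        * apply Hte in H; destruct H as [->|Hx].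
          -- destruct (Hends (snd (edge_at E j)) (or_intror eq_refl)) as [-> | ->];
             simpl; auto.
          -- right; apply Hend; assumption. }
  destruct (Hgrow (m - 2)%nat ltac:(lia))
    as (t & V & HN & HI & HA & HL & HS & HV & HVl & HVm & Hcov & Hend).
  exists t; split; [|assumption]; repeat split; auto.
  - lia.
  - intros v Hv; apply Hcov.
    apply (NoDup_length_incl HV (l' := seq 0 m)); [rewrite length_seq; lia|assumption|].
    apply in_seq; lia.
Qed.

(** The greedy edge set, started from the discrete labelling, is thinned to a tree, which costs
    nothing for nonnegative weights. Having this for all weights is the linear programming dual of a
    fractional packing of c trees. *)
Lemma light_spanning_tree m E c w :
  (2 <= m)%nat -> valid_graph m E -> is_mmi m E c -> 0 < c ->
  (forall j, 0 <= w j) ->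
  exists t, spanning_tree m E t /\
    c * sum w (tree_edges t) <= sum w (seq 0 (length E)).
Proof.
  intros Hm HE Hmmi Hc Hw.
  assert (Hlt : forall j, In j (seq 0 (length E)) -> (j < length E)%nat)
    by (intros j Hj; apply in_seq in Hj; lia).
  destruct (greedy_tree m E c w (seq 0 (length E)) (fun v => v) 0)
    as (F & HF1 & HF2 & HF3 & _ & HF5); try assumption; auto.
  - lia.
  - apply seq_NoDup.
  - intros comp' _; apply mmi_cut; assumption.
  - destruct (connects_spanning_tree m E F) as (t & Ht & Hincl); auto.
    exists t; split; [assumption|].
    rewrite !(sum_ext (fun j => w j - 0) w) in HF5 by (intros; lra).
    eapply Rle_trans; [|exact HF5]; apply Rmult_le_compat_l; [lra|].
    apply sum_NoDup_incl; auto; apply Ht.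
Qed.

Fixpoint load (ts : list tree) (j : nat) : nat :=
  match ts with
  | [] => 0
  | t :: ts' => (if memb (tree_edges t) j then 1 else 0) + load ts' j
  end.

(* Multiplicative weights: each new tree is light for the weights (1 + x)^load. *)
Lemma trees_with_small_potential m E c x k :
  (2 <= m)%nat -> valid_graph m E -> is_mmi m E c -> 0 < c -> 0 < x ->
  exists ts, length ts = k /\ Forall (spanning_tree m E) ts /\
    sum (fun j => (1 + x) ^ load ts j) (seq 0 (length E))
    <= INR (length E) * (1 + x / c) ^ k.
Proof.
  intros Hm HE Hmmi Hc Hx; induction k as [|k (ts & Hlen & Hts & Hpot)].
  - exists []; repeat split; auto; simpl; rewrite sum_const, length_seq; lra.
  - set (w := fun j => (1 + x) ^ load ts j) in *.
    destruct (light_spanning_tree m E c w) as (t & Ht & Hlight); auto.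
    { intros j; apply pow_le; lra. }
    exists (t :: ts); split; [simpl; lia|]; split; [constructor; assumption|].
    (* The new tree multiplies the weight of its own edges by 1 + x, so the potential grows by x
       w(t), at most x/c times its value. *)
    transitivity (sum w (seq 0 (length E)) + x * sum w (tree_edges t)).
    + rewrite (sum_ext _ (fun j => w j + x * (if memb (tree_edges t) j then w j else 0))).
      * rewrite sum_plus, sum_scal, <- sum_filter; apply Rplus_le_compat_l.
        apply Rmult_le_compat_l; [lra|]; apply sum_NoDup_incl.
        -- apply NoDup_filter, seq_NoDup.
        -- intros j Hj; apply filter_In in Hj; apply membP; tauto.
        -- intros; apply pow_le; lra.
      * intros j _; unfold w; cbn [load]; destruct (memb (tree_edges t) j); simpl; lra.
    + assert (Hxc : 0 < x / c) by (apply Rdiv_lt_0_compat; assumption).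
      apply (Rmult_le_compat_l (x / c)) in Hlight; [|lra].
      replace (x / c * (c * sum w (tree_edges t))) with (x * sum w (tree_edges t))
        in Hlight by (field; lra).
      apply (Rmult_le_compat_r (1 + x / c)) in Hpot; [|lra]; cbn [pow]; lra.
Qed.

(** A load above n would put a term of at least (1 + x)^(n+1) into the potential. Taking logarithms,
    with ln(1 + x/c) <= x/c, contradicts the bound on k. *)
Lemma load_le_of_potential (E : list (nat * nat)) ts x k n c :
  0 < c -> 0 < x ->
  sum (fun j => (1 + x) ^ load ts j) (seq 0 (length E))
    <= INR (length E) * (1 + x / c) ^ k ->
  ln (INR (length E)) + INR k * (x / c) <= INR n * ln (1 + x) ->
  forall j, (j < length E)%nat -> (load ts j <= n)%nat.
Proof.
  intros Hc Hx Hpot Hk j Hj; apply Nat.nlt_ge; intros Hn.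
  assert (Hxc : 0 < x / c) by (apply Rdiv_lt_0_compat; assumption).
  assert (HEp : 0 < INR (length E)) by (apply lt_0_INR; lia).
  assert (Hln : 0 < ln (1 + x)) by (rewrite <- ln_1; apply ln_increasing; lra).
  assert (Hj1 : (1 + x) ^ S n <= INR (length E) * (1 + x / c) ^ k).
  { eapply Rle_trans; [|exact Hpot].
    apply Rle_trans with (sum (fun j => (1 + x) ^ load ts j) [j]).
    - simpl; rewrite Rplus_0_r; apply (Rle_pow _ (S n)); [lra|lia].
    - apply sum_NoDup_incl; [repeat constructor; auto| |].
      + intros i [<-|[]]; apply in_seq; lia.
      + intros; apply pow_le; lra. }
  assert (Hl : ln ((1 + x) ^ S n) <= ln (INR (length E) * (1 + x / c) ^ k)).
  { destruct Hj1 as [Hj1|Hj1]; [left; apply ln_increasing|rewrite Hj1; lra].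
    - apply pow_lt; lra.
    - exact Hj1. }
  rewrite ln_mult, !ln_pow, S_INR in Hl by (try apply pow_lt; lra).
  assert (H1 := ln_le_sub1 (1 + x / c) ltac:(lra)).
  assert (H2 : INR k * ln (1 + x / c) <= INR k * (x / c))
    by (apply Rmult_le_compat_l; [apply pos_INR|lra]).
  lra.
Qed.

Lemma nat_floor y : 0 <= y -> exists k, INR k <= y < INR k + 1.
Proof.
  intros Hy; destruct (archimed y) as [H1 H2].
  assert (Hup : (0 < up y)%Z) by (apply lt_IZR; lra).
  exists (Z.to_nat (up y - 1)); rewrite INR_IZR_INZ, Z2Nat.id, minus_IZR by lia; lra.
Qed.

(** Trees in the original graph, made disjoint later by n copies of each edge. The cap on their
    number keeps the communication below (m - 2) n c and makes a longest packing exist. *)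
Definition packing (m n : nat) (E : list (nat * nat)) (c : R) (ts : list tree) : Prop :=
  Forall (spanning_tree m E) ts /\
  (forall j, (j < length E)%nat -> (load ts j <= n)%nat) /\
  INR (length ts) <= INR n * c.

Lemma packing_nil m n E c : 0 <= c -> packing m n E c [].
Proof.
  intros Hc; repeat split; [constructor|simpl; lia|].
  apply Rmult_le_pos; [apply pos_INR|assumption].
Qed.

Lemma packing_rate m E c eps :
  (2 <= m)%nat -> valid_graph m E -> is_mmi m E c -> 0 < eps ->
  exists n0, forall n, (n0 <= n)%nat ->
    exists ts, packing m n E c ts /\ INR n * (c - eps) <= INR (length ts).
Proof.
  intros Hm HE Hmmi Heps; assert (Hc0 := mmi_nonneg m E c HE Hmmi).
  destruct (Rle_lt_or_eq_dec 0 c Hc0) as [Hc| <-].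
  2:{ exists 0%nat; intros n _; exists []; split; [apply packing_nil; lra|].
      simpl; assert (Hn := pos_INR n); nra. }
  assert (HEp : 1 <= INR (length E)).
  { destruct (light_spanning_tree m E c (fun _ => 0)) as (t & Ht & _); auto; [intros; lra|].
    change 1 with (INR 1); apply le_INR.
    destruct Ht as (_ & Ht & _); specialize (Ht _ (or_introl eq_refl)); lia. }
  assert (HlE : 0 <= ln (INR (length E))).
  { destruct HEp as [HEp|HEp]; [rewrite <- ln_1; left; apply ln_increasing; lra|].
    rewrite <- HEp, ln_1; lra. }
  (* As ln(1 + x) >= x (1 - x), this step size costs eps/2 per copy: c (1 - x) = c - eps/2. The
     other half of eps absorbs, for n above the threshold [n0], the constant [C] and the 1 lost by
     rounding. *)
  set (x := eps / (2 * c)); assert (Hx : 0 < x) by (apply Rdiv_lt_0_compat; lra).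
  assert (Hcx : 0 < c / x) by (apply Rdiv_lt_0_compat; assumption).
  set (C := ln (INR (length E)) * (c / x)).
  destruct (nat_floor (2 * (C + 1) / eps)) as (n0 & _ & Hn0).
  { apply Rmult_le_pos; [unfold C; nra|left; apply Rinv_0_lt_compat; assumption]. }
  exists (S n0); intros n Hn; apply le_INR in Hn; rewrite S_INR in Hn.
  assert (Hln : x * (1 - x) <= ln (1 + x) <= x).
  { split; [|assert (H1 := ln_le_sub1 (1 + x) ltac:(lra)); lra].
    assert (H1 := ln_le_sub1 (/ (1 + x)) ltac:(apply Rinv_0_lt_compat; lra)).
    rewrite ln_Rinv in H1 by lra.
    apply Rle_trans with (1 - / (1 + x)); [|lra].
    apply Rmult_le_reg_r with (1 + x); [lra|].
    rewrite Rmult_minus_distr_r, Rinv_l by lra; nra. }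
  (* The largest real number of trees that [load_le_of_potential] allows. *)
  set (y := (INR n * ln (1 + x) - ln (INR (length E))) * (c / x)).
  assert (Hxx : x * (c / x) = c) by (field; lra).
  assert (Hn' := pos_INR n).
  assert (Hylo : INR n * (c - eps) + 1 <= y).
  { assert (H1 : INR n * (x * (1 - x)) * (c / x) <= INR n * ln (1 + x) * (c / x)).
    { apply Rmult_le_compat_r; [lra|]; apply Rmult_le_compat_l; lra. }
    replace (INR n * (x * (1 - x)) * (c / x)) with (INR n * (c - eps / 2)) in H1
      by (unfold x; field; lra).
    assert (H2 : C + 1 <= INR n * (eps / 2)).
    { apply Rmult_lt_compat_r with (r := eps / 2) in Hn0; [|lra].
      replace (2 * (C + 1) / eps * (eps / 2)) with (C + 1) in Hn0 by (field; lra).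
      nra. }
    unfold y; unfold C in H2; lra. }
  assert (Hyhi : y <= INR n * c).
  { unfold y; rewrite Rmult_minus_distr_r.
    assert (INR n * ln (1 + x) * (c / x) <= INR n * x * (c / x)).
    { apply Rmult_le_compat_r; [lra|]; apply Rmult_le_compat_l; lra. }
    assert (0 <= ln (INR (length E)) * (c / x)) by (apply Rmult_le_pos; lra).
    rewrite (Rmult_assoc (INR n) x), Hxx in H; lra. }
  destruct (Rle_lt_dec 0 y) as [Hy|Hy].
  2:{ exists []; split; [apply packing_nil; lra|simpl; lra]. }
  destruct (nat_floor y Hy) as (k & Hk1 & Hk2).
  destruct (trees_with_small_potential m E c x k) as (ts & Hlen & Hts & Hpot); auto.
  exists ts; split; [|rewrite Hlen; lra].
  split; [assumption|]; split; [|rewrite Hlen; lra].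
  apply (load_le_of_potential E ts x k n c); auto.
  apply Rmult_le_compat_r with (r := x / c) in Hk1;
    [|left; apply Rdiv_lt_0_compat; assumption].
  replace (y * (x / c)) with (INR n * ln (1 + x) - ln (INR (length E))) in Hk1
    by (unfold y; field; lra).
  lra.
Qed.

(** * Secret keys from tree packings *)

Definition relabel (phi : nat -> nat) (t : tree) : tree :=
  (phi (fst t), map (fun s => (fst s, (phi (fst (snd s)), phi (snd (snd s))))) (snd t)).

Lemma tree_edges_relabel phi t : tree_edges (relabel phi t) = map phi (tree_edges t).
Proof. unfold tree_edges, relabel; simpl; rewrite !map_map; reflexivity. Qed.

(* Each tree of the packing receives fresh copies of its edges. *)
Fixpoint place (n : nat) (ts : list tree) : list tree :=
  match ts with
  | [] => []
  | t :: ts' => relabel (fun j => j * n + load ts' j)%nat t :: place n ts'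
  end.

Definition placed_tree (m n : nat) (E : list (nat * nat)) (t : tree) : Prop :=
  attached (fun v p => incident v (edge_at E (p / n))) (fst t) (snd t) /\
  (length (snd t) + 2 = m)%nat /\
  (forall s, In s (snd t) -> (fst s < m)%nat) /\
  (forall v, (v < m)%nat ->
     exists p, In p (tree_edges t) /\ incident v (edge_at E (p / n)) = true).

Lemma attached_relabel (inc inc' : nat -> nat -> bool) phi r s :
  (forall v j, In j (tree_edges (r, s)) -> inc' v (phi j) = inc v j) ->
  attached inc r s ->
  attached inc' (fst (relabel phi (r, s))) (snd (relabel phi (r, s))).
Proof.
  induction s as [|[v [p j]] s IH]; intros Hphi; simpl; [auto|].
  intros (H1 & H2 & H3 & H4).
  assert (Hsub : forall x, In x (tree_edges (r, s)) -> In x (tree_edges (r, (v, (p, j)) :: s)))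
    by (unfold tree_edges; simpl; tauto).
  rewrite !Hphi by (auto; unfold tree_edges; simpl; tauto).
  repeat split; auto.
  - change (In (phi p) (tree_edges (relabel phi (r, s)))).
    rewrite tree_edges_relabel; apply in_map, H3.
Qed.

Lemma copy_div_mod n j k : (k < n)%nat -> ((j * n + k) / n = j /\ (j * n + k) mod n = k)%nat.
Proof.
  intros Hk; split.
  - rewrite Nat.div_add_l, Nat.div_small by lia; lia.
  - rewrite Nat.add_comm, Nat.Div0.mod_add; apply Nat.mod_small, Hk.
Qed.

(** Copies of an edge are handed out in increasing order: those in use have index below its load, so
    the copy numbered by the current load is free. This invariant gives disjointness. *)
Lemma place_spec m n E ts :
  Forall (spanning_tree m E) ts ->
  (forall j, (j < length E)%nat -> (load ts j <= n)%nat) ->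
  Forall (placed_tree m n E) (place n ts) /\
  NoDup (concat (map tree_edges (place n ts))) /\
  forall p, In p (concat (map tree_edges (place n ts))) ->
    (p < n * length E)%nat /\ (p mod n < load ts (p / n))%nat.
Proof.
  induction 1 as [|t ts Ht Hts IH]; cbn [place load map concat]; intros Hload.
  - split; [constructor|]; split; [constructor|intros p []].
  - destruct IH as (IH1 & IH2 & IH3).
    { intros j Hj; specialize (Hload j Hj); lia. }
    destruct Ht as (HN & HE & HA & HL & HS & HC).
    assert (Hnew : forall j, In j (tree_edges t) -> (load ts j < n)%nat).
    { intros j Hj; specialize (Hload j (HE j Hj)).
      rewrite (proj2 (membP _ _) Hj) in Hload; lia. }
    set (phi := fun j => (j * n + load ts j)%nat).
    assert (Hphi : forall j, In j (tree_edges t) ->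
      (phi j / n = j /\ phi j mod n = load ts j)%nat)
      by (intros j Hj; apply copy_div_mod, Hnew, Hj).
    rewrite tree_edges_relabel; repeat split.
    + constructor; [|assumption]; repeat split.
      * destruct t as [r s]; eapply attached_relabel; [|exact HA].
        intros v j Hj; simpl; rewrite (proj1 (Hphi j Hj)); reflexivity.
      * unfold relabel; simpl; rewrite length_map; assumption.
      * unfold relabel; simpl; intros s Hs; apply in_map_iff in Hs.
        destruct Hs as (s' & <- & Hs'); simpl; auto.
      * intros v Hv; destruct (HC v Hv) as (j & Hj & Hvj).
        exists (phi j); rewrite tree_edges_relabel; split; [apply in_map, Hj|].
        rewrite (proj1 (Hphi j Hj)); assumption.
    + apply NoDup_app; [|assumption|].
      * apply NoDup_map_NoDup_ForallPairs; [|assumption].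
        intros i j Hi Hj Hij; rewrite <- (proj1 (Hphi i Hi)), <- (proj1 (Hphi j Hj)), Hij.
        reflexivity.
      * intros p Hp Hp'; apply in_map_iff in Hp; destruct Hp as (j & <- & Hj).
        apply IH3 in Hp'; destruct (Hphi j Hj) as [E1 E2].
        rewrite E1, E2 in Hp'; lia.
    + apply in_app_iff in H; destruct H as [Hp|Hp]; [|apply IH3, Hp].
      apply in_map_iff in Hp; destruct Hp as (j & <- & Hj).
      assert (H1 := HE j Hj); assert (H2 := Hnew j Hj); unfold phi; nia.
    + apply in_app_iff in H; destruct H as [Hp|Hp].
      * apply in_map_iff in Hp; destruct Hp as (j & <- & Hj).
        destruct (Hphi j Hj) as [-> ->]; rewrite (proj2 (membP _ _) Hj); lia.
      * apply IH3 in Hp; lia.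
Qed.

(** Turns the fact that [f] determines [g] into a function of the value of [f], by searching for a
    sample with that value. The default 0 is returned only for values that [f] does not take. *)
Definition decode {T} (eqd : forall x y : T, {x = y} + {x <> y}) N
  (f : list bool -> T) (g : list bool -> nat) (u : T) : nat :=
  match find (fun w => bdec eqd (f w) u) (all_bits N) with Some w => g w | None => 0 end.

Lemma decode_correct {T} (eqd : forall x y : T, {x = y} + {x <> y}) N f g w :
  (forall x y, f x = f y -> g x = g y) -> In w (all_bits N) ->
  decode eqd N f g (f w) = g w.
Proof.
  intros Hfg Hw; unfold decode; destruct (find _ _) as [x|] eqn:Hx.
  - apply find_some in Hx; destruct Hx as [_ Hx]; apply Hfg.
    unfold bdec in Hx; destruct (eqd _ _); congruence.
  - apply (find_none _ _ Hx) in Hw; unfold bdec in Hw; destruct (eqd _ _); congruence.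
Qed.

Definition message (s : nat * (nat * nat)) (w : list bool) : nat :=
  Nat.b2n (xorb (nth (fst (snd s)) w false) (nth (snd (snd s)) w false)).

Definition tree_protocol (n : nat) (E : list (nat * nat)) (pts : list tree) : protocol :=
  map (fun s => (fst s, fun o (_ : list nat) =>
                   decode eq_lb (n * length E) (obs n E (fst s)) (message s) o))
      (concat (map snd pts)).

Lemma transcript_non_interactive {S} n E (sender : S -> nat) (g : S -> list bool -> nat) l w :
  transcript n E (map (fun s => (sender s, fun o (_ : list nat) => g s o)) l) w
  = map (fun s => g s (obs n E (sender s) w)) l.
Proof.
  assert (H : forall acc,
    run (map (fun s => (sender s, fun o (_ : list nat) => g s o)) l) (fun i => obs n E i w) acc
    = acc ++ map (fun s => g s (obs n E (sender s) w)) l); [|apply (H [])].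
  induction l as [|s l IH]; intros acc; simpl.
  - rewrite app_nil_r; reflexivity.
  - rewrite IH, <- app_assoc; reflexivity.
Qed.

Lemma attached_In inc r s v p j : attached inc r s -> In (v, (p, j)) s ->
  inc v p = true /\ inc v j = true /\
  In p (tree_edges (r, s)) /\ In j (tree_edges (r, s)).
Proof.
  induction s as [|[v' [p' j']] s IH]; simpl; [tauto|]; intros (H1 & H2 & H3 & H4).
  assert (Hsub : forall x, In x (tree_edges (r, s)) ->
     In x (tree_edges (r, (v', (p', j')) :: s))) by (unfold tree_edges; simpl; tauto).
  intros [Heq|Hs].
  - injection Heq as -> -> ->; repeat split; auto; unfold tree_edges; simpl in *; tauto.
  - destruct (IH H4 Hs) as (? & ? & ? & ?); repeat split; auto; apply Hsub; assumption.
Qed.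

(** The global flip, stated for two samples with the same messages: their difference is carried from
    [p] to [j] by each step, so it is constant on the tree. *)
Lemma tree_difference inc r s x y : attached inc r s ->
  (forall st, In st s -> message st x = message st y) ->
  forall p, In p (tree_edges (r, s)) ->
    xorb (nth p x false) (nth p y false) = xorb (nth r x false) (nth r y false).
Proof.
  induction s as [|[v [q j]] s IH]; intros HA Hmsg p.
  - intros [<-|[]]; reflexivity.
  - simpl in HA; destruct HA as (_ & _ & Hq & HA).
    assert (IH' := IH HA (fun st Hst => Hmsg st (or_intror Hst))).
    intros [<-|[<-|Hp]]; [reflexivity| |apply IH'; right; exact Hp].
    simpl; rewrite <- (IH' q Hq).
    assert (Hm := Hmsg _ (or_introl eq_refl)); unfold message in Hm; simpl in Hm.
    destruct (nth q x false), (nth q y false), (nth j x false), (nth j y false);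
      simpl in *; congruence.
Qed.

(** Keys are natural numbers, so bits are packed in binary. Trailing zeros are lost, hence
    injectivity only among lists of equal length. *)
Fixpoint code (l : list bool) : nat :=
  match l with
  | [] => 0
  | b :: l' => Nat.b2n b + 2 * code l'
  end.

Lemma code_inj l l' : length l = length l' -> code l = code l' -> l = l'.
Proof.
  revert l'; induction l as [|b l IH]; intros [|b' l']; simpl; try discriminate; auto.
  intros Hlen Hc; injection Hlen as Hlen.
  assert (b = b') as -> by (destruct b, b'; simpl in Hc; auto; lia).
  f_equal; apply IH; [assumption|lia].
Qed.

Definition tree_key (pts : list tree) (w : list bool) : nat :=
  code (map (fun t => nth (fst t) w false) pts).

Lemma tree_key_eq pts x y : tree_key pts x = tree_key pts y <->
  forall t, In t pts -> nth (fst t) x false = nth (fst t) y false.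
Proof.
  unfold tree_key; split; intros H.
  - apply code_inj in H; [|rewrite !length_map; reflexivity].
    intros t Ht; exact (ext_in_map H t Ht).
  - f_equal; apply map_ext_in; exact H.
Qed.

Lemma length_tree_edges_concat (pts : list tree) :
  length (concat (map tree_edges pts)) = (length pts + length (concat (map snd pts)))%nat.
Proof.
  induction pts as [|t pts IH]; [reflexivity|]; simpl.
  rewrite !length_app, length_map, IH; lia.
Qed.

Lemma length_steps_concat m n E pts : Forall (placed_tree m n E) pts ->
  INR (length (concat (map snd pts))) = (INR m - 2) * INR (length pts).
Proof.
  induction 1 as [|t pts Ht Hpts IH]; [simpl; lra|].
  cbn [map concat]; rewrite length_app, plus_INR, IH; cbn [length]; rewrite S_INR.
  destruct Ht as (_ & <- & _); rewrite plus_INR; simpl; lra.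
Qed.

(** Secrecy by counting: key and transcript determine all tree bits, so H(K,F) >= trees + steps,
    while H(K) <= trees and H(F) <= steps. This forces I(K;F) <= 0 and H(K) >= trees. *)
Lemma packing_protocol m n E c ts :
  valid_graph m E -> packing m n E c ts ->
  let N := (n * length E)%nat in
  exists F K J,
    Forall (fun st => (fst st < m)%nat) F /\
    log2 (INR (card_range eq_ln N (transcript n E F))) <= (INR m - 2) * INR (length ts) /\
    (forall w i, In w (all_bits N) -> (i < m)%nat ->
       J i (obs n E i w) (transcript n E F w) = K w) /\
    mutinf Nat.eq_dec eq_ln N K (transcript n E F) <= 0 /\
    INR (length ts) <= ent Nat.eq_dec N K.
Proof.
  intros HE (Hts & Hload & _) N.
  destruct (place_spec m n E ts Hts Hload) as (Hpl & Hnd & Hlt).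
  set (pts := place n ts) in *.
  assert (Hlen : length pts = length ts).
  { unfold pts; clear; induction ts; simpl; congruence. }
  set (steps := concat (map snd pts)); set (F := tree_protocol n E pts).
  set (msgs := fun w => map (fun s => message s w) steps).
  assert (Hstep : forall s, In s steps -> exists t, In t pts /\ In s (snd t)).
  { intros s Hs; unfold steps in Hs; rewrite <- flat_map_concat_map in Hs.
    apply in_flat_map in Hs; assumption. }
  rewrite Forall_forall in Hpl.
  assert (Htedge : forall t p, In t pts -> In p (tree_edges t) ->
      In p (concat (map tree_edges pts))).
  { intros t p Ht Hp; apply in_concat; exists (tree_edges t).
    split; [apply in_map|]; assumption. }
  assert (Hobs : forall i p x y, In p (concat (map tree_edges pts)) ->
     incident i (edge_at E (p / n)) = true ->
     obs n E i x = obs n E i y -> nth p x false = nth p y false).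
  { intros i p x y Hp Hi; rewrite obs_eq, agreeP; intros H; apply H.
    apply filter_In; split; [apply in_seq; apply Hlt in Hp; lia|assumption]. }
  assert (HFtr : forall w, In w (all_bits N) -> transcript n E F w = msgs w).
  { intros w Hw; unfold F, tree_protocol.
    rewrite (transcript_non_interactive n E fst
      (fun s o => decode eq_lb (n * length E) (obs n E (fst s)) (message s) o)).
    apply map_ext_in; intros [v [p j]] Hs; apply decode_correct; [|assumption].
    intros x y Hxy; destruct (Hstep _ Hs) as ([r s] & Ht & Hin).
    destruct (Hpl _ Ht) as (HA & _).
    destruct (attached_In _ _ _ _ _ _ HA Hin) as (H1 & H2 & H3 & H4).
    unfold message; simpl.
    rewrite (Hobs v p x y), (Hobs v j x y); auto; eapply Htedge; eauto. }
  assert (Hdiff : forall x y t p, msgs x = msgs y -> In t pts -> In p (tree_edges t) ->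
    xorb (nth p x false) (nth p y false)
    = xorb (nth (fst t) x false) (nth (fst t) y false)).
  { intros x y [r s] p Hmsg Ht Hp; destruct (Hpl _ Ht) as (HA & _).
    apply (tree_difference _ r s x y HA); [|assumption]; intros st Hst.
    apply (ext_in_map Hmsg), in_concat; exists s; split; [|assumption].
    apply in_map_iff; exists (r, s); auto. }
  set (K := tree_key pts).
  (* Terminal [i] sees some edge of every tree; there the two samples agree, so the constant
     difference is zero and they agree at the root. *)
  assert (Hrec : forall i x y, (i < m)%nat ->
     (obs n E i x, msgs x) = (obs n E i y, msgs y) -> K x = K y).
  { intros i x y Hi Hxy; injection Hxy as Ho Hmsg; apply tree_key_eq; intros t Ht.
    destruct (Hpl t Ht) as (_ & _ & _ & Hcov); destruct (Hcov i Hi) as (p & Hp & Hip).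
    assert (Hd := Hdiff x y t p Hmsg Ht Hp).
    rewrite (Hobs i p x y (Htedge t p Ht Hp) Hip Ho), xorb_nilpotent in Hd.
    symmetry in Hd; apply xorb_eq in Hd; assumption. }
  exists F, K, (fun i o f => decode (prod_eq_dec eq_lb eq_ln) N
                               (fun w => (obs n E i w, msgs w)) K (o, f)).
  assert (HL := length_steps_concat m n E pts (proj2 (Forall_forall _ _) Hpl)).
  fold steps in HL; rewrite Hlen in HL.
  assert (Hcard : log2 (INR (card_range eq_ln N (transcript n E F)))
                  <= INR (length steps)).
  (* Each message is 0 or 1, so transcripts embed in the bit strings with one bit per step. *)
  { rewrite <- (log2_pow2 (length steps)), <- INR_length_all_bits; apply log2_le.
    - apply lt_0_INR; unfold card_range.
      destruct (all_bits N) as [|w l] eqn:Hbits; [destruct (all_bits_nonempty N Hbits)|].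
      assert (Hin : In (transcript n E F w)
         (nodup eq_ln (map (transcript n E F) (w :: l)))) by (apply nodup_In; simpl; auto).
      destruct (nodup _ _); [destruct Hin|simpl; lia].
    - apply le_INR; rewrite <- (length_map (map Nat.b2n)); apply NoDup_incl_length.
      + apply NoDup_nodup.
      + intros f; rewrite nodup_In, in_map_iff; intros (w & <- & Hw).
        rewrite HFtr by assumption; unfold msgs; clear; induction steps as [|s l IH].
        * left; reflexivity.
        * apply in_map_iff in IH; destruct IH as (b & Hb & Hin).
          apply in_map_iff; cbn [length all_bits map].
          exists (xorb (nth (fst (snd s)) w false) (nth (snd (snd s)) w false) :: b).
          split; [simpl; rewrite Hb; reflexivity|].
          apply in_flat_map; exists b; split; [assumption|].
          destruct (xorb _ _); simpl; auto. }
  assert (HF := ent_le_log_card eq_ln N (transcript n E F)).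
  assert (HK : ent Nat.eq_dec N K <= INR (length ts)).
  { rewrite <- Hlen, <- (length_map (fun t : tree => fst t) pts).
    eapply Rle_trans; [|apply (entR_agree_le N)]; rewrite ent_entR.
    apply entR_le; [apply equivb_agree|]; intros x y _ _.
    rewrite agreeP, kerP; intros H; apply tree_key_eq; intros t Ht.
    apply H, in_map_iff; exists t; auto. }
  assert (HKF : INR (length ts) + INR (length steps)
     <= entR (all_bits N) (meet (ker Nat.eq_dec K) (ker eq_ln (transcript n E F)))).
  { rewrite <- plus_INR, <- Hlen; unfold steps; rewrite <- length_tree_edges_concat.
    rewrite <- (entR_agree N) by
      (try assumption; intros p Hp; apply in_seq; apply Hlt in Hp; unfold N; lia).
    apply entR_le; [apply equivb_meet; apply equivb_ker|]; intros x y Hx Hy.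
    unfold meet; rewrite andb_true_iff, !kerP, !HFtr by assumption.
    intros [HKxy Hmsg]; apply agreeP; intros p Hp; apply in_concat in Hp.
    destruct Hp as (l & Hl & Hp); apply in_map_iff in Hl; destruct Hl as (t & <- & Ht).
    apply xorb_eq; rewrite (Hdiff x y t p Hmsg Ht Hp).
    rewrite (proj1 (tree_key_eq pts x y) HKxy t Ht); apply xorb_nilpotent. }
  assert (HS := entR_subadd (all_bits N) (ker Nat.eq_dec K) (ker eq_ln (transcript n E F))
                  (equivb_ker _ _) (equivb_ker _ _)).
  rewrite <- !ent_entR in HS.
  split; [|split; [|split; [|split]]].
  - apply Forall_map, Forall_forall; intros s Hs; simpl.
    destruct (Hstep s Hs) as (t & Ht & Hst); apply (Hpl t Ht); assumption.
  - rewrite <- HL; exact Hcard.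
  - intros w i Hw Hi; rewrite HFtr by assumption.
    apply (decode_correct (prod_eq_dec eq_lb eq_ln) N (fun w => (obs n E i w, msgs w)) K w);
      [|assumption].
    intros x y; apply Hrec, Hi.
  - unfold mutinf; rewrite ent_pair; lra.
  - lra.
Qed.

Lemma longest_list {T} (P : list T -> Prop) B l0 : P l0 ->
  (forall l, P l -> (length l <= B)%nat) ->
  exists l, P l /\ forall l', P l' -> (length l' <= length l)%nat.
Proof.
  intros H0 HB; remember (B - length l0)%nat as d eqn:Hd.
  revert l0 H0 Hd; induction d as [d IH] using lt_wf_ind; intros l0 H0 Hd.
  destruct (classic (exists l', P l' /\ (length l0 < length l')%nat)) as [(l' & H1 & H2)|Hno].
  - apply (IH (B - length l')%nat) with l'; auto; assert (H3 := HB l' H1); lia.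
  - exists l0; split; [assumption|]; intros l' H1; apply Nat.nlt_ge; intros H2.
    apply Hno; eauto.
Qed.

(** The protocols may depend on n but not on eps, whereas [packing_rate] produces packings for a
    given eps. A longest packing for each n is at least as good as all of them. *)
Lemma SK_achievable_trees m E c : (2 <= m)%nat -> valid_graph m E -> is_mmi m E c ->
  SK_achievable m E ((INR m - 2) * c).
Proof.
  intros Hm HE Hmmi; assert (Hc0 := mmi_nonneg m E c HE Hmmi).
  assert (Hm2 := le_INR _ _ Hm); simpl in Hm2.
  assert (Hbest : forall n, exists ts, packing m n E c ts /\
    forall ts', packing m n E c ts' -> (length ts' <= length ts)%nat).
  { intros n; destruct (nat_floor (INR n * c)) as (B & _ & HB).
    { apply Rmult_le_pos; [apply pos_INR|assumption]. }
    apply (longest_list _ B []); [apply packing_nil; assumption|].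
    intros ts (_ & _ & Hl); rewrite <- S_INR in HB.
    apply Nat.lt_succ_r, INR_lt; lra. }
  set (good := fun n (X : protocol * (list bool -> nat) *
                         (nat -> list bool -> list nat -> nat)) =>
    let '(F, K, J) := X in let N := (n * length E)%nat in
    exists ts, packing m n E c ts /\
      (forall ts', packing m n E c ts' -> (length ts' <= length ts)%nat) /\
      Forall (fun st => (fst st < m)%nat) F /\
      log2 (INR (card_range eq_ln N (transcript n E F))) <= (INR m - 2) * INR (length ts) /\
      (forall w i, In w (all_bits N) -> (i < m)%nat ->
         J i (obs n E i w) (transcript n E F w) = K w) /\
      mutinf Nat.eq_dec eq_ln N K (transcript n E F) <= 0 /\
      INR (length ts) <= ent Nat.eq_dec N K).
  assert (Hgood : forall n, exists X, good n X).
  { intros n; destruct (Hbest n) as (ts & Hts & Hmax).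
    destruct (packing_protocol m n E c ts HE Hts) as (F & K & J & H).
    exists (F, K, J), ts; auto. }
  set (sel := fun n => constructive_indefinite_description _ (Hgood n)).
  exists c; split; [assumption|].
  exists (fun n => fst (fst (proj1_sig (sel n)))), (fun n => snd (fst (proj1_sig (sel n)))),
    (fun n => snd (proj1_sig (sel n))); split.
  - intros n; assert (Hsel := proj2_sig (sel n)).
    destruct (proj1_sig (sel n)) as [[F K] J]; destruct Hsel as (ts & H); simpl; tauto.
  - intros eps Heps; destruct (packing_rate m E c eps Hm HE Hmmi Heps) as (n0 & Hn0).
    exists n0; intros n Hn1 Hn; destruct (Hn0 n Hn) as (ts' & Hts' & Hrate).
    assert (Hsel := proj2_sig (sel n)); destruct (proj1_sig (sel n)) as [[F K] J].
    destruct Hsel as (ts & Hts & Hmax & _ & Hcard & Hcorr & Hmut & Hent).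
    cbn [fst snd]; cbv zeta.
    assert (Hle := le_INR _ _ (Hmax ts' Hts')).
    assert (Hup := proj2 (proj2 Hts)).
    apply le_INR in Hn1; simpl in Hn1.
    assert (Hinv : 0 < / INR n) by (apply Rinv_0_lt_compat; lra).
    repeat split.
    + apply Rle_trans with (/ INR n * ((INR m - 2) * (INR n * c))).
      * apply Rmult_le_compat_l; [lra|].
        eapply Rle_trans; [exact Hcard|]; apply Rmult_le_compat_l; lra.
      * replace (/ INR n * ((INR m - 2) * (INR n * c))) with ((INR m - 2) * c)
          by (field; lra); lra.
    + unfold prob; rewrite forallb_filter_id.
      * rewrite Rdiv_diag; [lra|]; rewrite INR_length_all_bits.
        apply pow_nonzero; lra.
      * apply forallb_forall; intros w Hw; apply forallb_forall; intros i Hi.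
        apply Nat.eqb_eq, Hcorr; [assumption|]; apply in_seq in Hi; lia.
    + lra.
    + apply Rle_ge; replace (c - eps) with (/ INR n * (INR n * (c - eps))) by (field; lra).
      apply Rmult_le_compat_l; lra.
Qed.

(** * The equivalence *)

Lemma mmi_unique m E c c' : is_mmi m E c -> is_mmi m E c' -> c = c'.
Proof.
  intros ((P & HP & Hk & HD) & Hmin) ((P' & HP' & Hk' & HD') & Hmin').
  specialize (Hmin P' HP' Hk'); specialize (Hmin' P HP Hk); lra.
Qed.

Theorem theorem3 (m : nat) (E : list (nat * nat)) :
  (2 <= m)%nat -> valid_graph m E ->
  (RSK_maximal m E <-> typeS m E).
Proof.
  intros Hm HE; assert (Hm2 := le_INR _ _ Hm); simpl in Hm2; split.
  - intros (r & ((Rt & HRt & Hr) & _) & Hlow & Hglb) P HP Hk.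
    apply Rnot_lt_le; intros Hlt; rewrite Delta_singletons in Hlt by assumption.
    (* Were no rate achievable, every real would be a lower bound and [r] could not be the greatest.
       An achievable rate also supplies the minimum c, whose existence is not proved separately. *)
    assert (Hex : exists R0, SK_achievable m E R0).
    { apply NNPP; intros Hno; assert (Habs : r + 1 <= r); [|lra].
      apply Hglb; intros y [_ Hy]; destruct Hno; eauto. }
    destruct Hex as (R0 & c & Hc & _).
    assert (HrP := omniscience_ge m E P Rt HE HP Hk HRt).
    assert (HcP := proj2 Hc P HP Hk); assert (Hc0 := mmi_nonneg m E c HE Hc).
    assert (Hrc : r <= (INR m - 2) * c).
    { apply Hlow; split; [apply Rmult_le_pos; lra|apply SK_achievable_trees; assumption]. }
    (* The chain |E| - Delta(P) <= r <= (m - 2) c <= (m - 2) Delta(P) yields |E| <= (m - 1)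
       Delta(P), against [Hlt]. *)
    apply (Rmult_lt_compat_l (INR m - 1)) in Hlt; [|lra].
    replace ((INR m - 1) * (INR (length E) / (INR m - 1))) with (INR (length E)) in Hlt
      by (field; lra).
    nra.
  - intros HS; set (c := INR (length E) / (INR m - 1)).
    assert (Hc := typeS_mmi m E Hm HE HS); fold c in Hc.
    assert (Hr : INR (length E) - c = (INR m - 2) * c) by (unfold c; field; lra).
    exists (INR (length E) - c); split; [apply typeS_RCO; assumption|]; split.
    + intros y [_ Hy]; destruct (SK_achievable_ge m E y Hm HE Hy) as (c' & Hc' & Hle).
      rewrite Hr, (mmi_unique m E c c') by assumption; exact Hle.
    + intros z Hz; rewrite Hr; apply Hz; split.
      * apply Rmult_le_pos; [lra|apply (mmi_nonneg m E c HE Hc)].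
      * apply SK_achievable_trees; assumption.
Qed.
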